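(* Let $\ell>0$ and $\mu\in(0,1)$. Then there exists a constant $\omega>0$, depending only on $\ell$ and $\mu$, such that for every initial datum $(y_0,y_1)\in\mathcal V=\{f\in H^1(0,\ell): f(0)=0\}\times L^2(0,\ell)$ there exists a constant $M>0$, depending on $(y_0,y_1)$, $\ell$ and $\mu$, such that the energy $$E(t)=\frac12\int_0^\ell\left[y_x(x,t)^2+y_t(x,t)^2\right]dx$$ of the solution $y$ of $$ \begin{cases} y_{tt}(x,t)-y_{xx}(x,t)=0, & (x,t)\in(0,\ell)\times(0,+\infty),\\ y(0,t)=0, & t\in(0,+\infty),\\ y_x(\ell,t)=0, & t\in(0,2\ell),\\ y_x(\ell,t)=\mu\, y_t(\ell,t-2\ell), & t\in(2\ell,+\infty),\\ y(x,0)=y_0(x),\quad y_t(x,0)=y_1(x), & x\in(0,\ell), \end{cases} $$ satisfies $$E(t)\le M e^{-\omega t}\qquad\text{for all } t\ge 0.$$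
   Context: All functions are real-valued. Solutions are understood in the usual weak (finite-energy) sense: with $V=L^2(0,\ell)$ and $V_{1/2}=\{f\in H^1(0,\ell): f(0)=0\}$, the solution is the unique $y\in C([0,\infty);V_{1/2})\cap C^1([0,\infty);V)$ with $y(0)=y_0$, $y_t(0)=y_1$, whose trace $t\mapsto y(\ell,t)$ belongs to $H^1_{\rm loc}([0,\infty))$ (its derivative is denoted $y_t(\ell,\cdot)\in L^2_{\rm loc}$), and such that for every $f\in V_{1/2}$, in the sense of distributions in $t\in(0,\infty)$, $$\frac{d}{dt}\int_0^\ell y_t f\,dx+\int_0^\ell y_x f_x\,dx=g(t)f(\ell),$$ where $g(t)=0$ for $t\in(0,2\ell)$ and $g(t)=\mu\,y_t(\ell,t-2\ell)$ for $t>2\ell$. *)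

(* Defs.v *)
From HB Require Import structures.
From mathcomp Require Import all_boot all_order all_algebra.
From mathcomp Require Import all_classical all_reals all_analysis.

Set Implicit Arguments.
Unset Strict Implicit.
Unset Printing Implicit Defensive.

Import Order.TTheory GRing.Theory Num.Theory.
Import numFieldNormedType.Exports.

Local Open Scope classical_set_scope.
Local Open Scope ring_scope.

(* Elements of L^2(Om) are represented by functions on the whole line whose
   values outside Om are irrelevant. *)
Definition in_L2 (R : realType) (Om : set R) (f : R -> R) : Prop :=
  f \_ Om \in Lfun (@lebesgue_measure R) 2%:E.

Definition L2norm (R : realType) (Om : set R) (f : R -> R) : \bar R :=
  ('N[@lebesgue_measure R]_(2%:E)[EFin \o (f \_ Om)])%E.

Definition test_function (R : realType) (Om : set R) (phi : R -> R) : Prop :=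
  [/\ forall (n : nat) (x : R), derivable (phi^`(n))%classic x 1,
      compact (closure [set x | phi x != 0]) &
      closure [set x | phi x != 0] `<=` Om].

Definition weak_derivative (R : realType) (Om : set R) (u v : R -> R) : Prop :=
  forall phi : R -> R, test_function Om phi ->
    \int[@lebesgue_measure R]_(x in Om) (u x * (phi^`())%classic x) =
    - \int[@lebesgue_measure R]_(x in Om) (v x * phi x).

(* u is in H^1(Om) and v is (a representative of) its derivative *)
Definition in_H1 (R : realType) (Om : set R) (u v : R -> R) : Prop :=
  [/\ in_L2 Om u, in_L2 Om v & weak_derivative Om u v].

(* f is in V_{1/2} = {f in H^1(0,l) : f(0) = 0} and fx is its derivative.
   An element of H^1(0,l) is represented by its unique continuous
   representative on [0,l], so that its traces at 0 and l are the values
   f 0 and f l. *)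
Definition in_Vhalf (R : realType) (l : R) (f fx : R -> R) : Prop :=
  [/\ in_H1 `]0, l[ f fx, {within `[0, l], continuous f} & f 0 = 0].

(* The function g of the boundary condition y_x(l,t) = g(t), where z is the
   derivative y_t(l,.) of the trace. *)
Definition delayed_feedback (R : realType) (l mu : R) (z : R -> R) (t : R) : R :=
  if t < 2 * l then 0 else mu * z (t - 2 * l).

(* The time variable comes first: y t x stands for y(x,t).  The functions y_x
   and y_t are representatives of the space derivative and of the
   L^2(0,l)-valued time derivative of y, and z is the weak derivative of the
   trace y(l,.). *)
Record weak_solution (R : realType) (l mu : R) (y0 y1 : R -> R)
    (y y_x y_t : R -> R -> R) (z : R -> R) : Prop := WeakSolution {
  sol_Vhalf : forall t : R, 0 <= t -> in_Vhalf l (y t) (y_x t) ;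
  sol_cont : forall t : R, 0 <= t ->
    (L2norm `]0, l[ (y s \- y t) @[s --> within `[0, +oo[ (nbhs t)] --> 0%E) /\
    (L2norm `]0, l[ (y_x s \- y_x t)
       @[s --> within `[0, +oo[ (nbhs t)] --> 0%E) ;
  sol_L2 : forall t : R, 0 <= t -> in_L2 `]0, l[ (y_t t) ;
  (* one-sided at t = 0; t^' is the deleted neighborhood filter of t *)
  sol_derivable : forall t : R, 0 <= t ->
    L2norm `]0, l[ (fun x => (s - t)^-1 * (y s x - y t x) - y_t t x)
      @[s --> within `[0, +oo[ t^'] --> 0%E ;
  sol_deriv_cont : forall t : R, 0 <= t ->
    L2norm `]0, l[ (y_t s \- y_t t)
      @[s --> within `[0, +oo[ (nbhs t)] --> 0%E ;
  sol_init : {ae @lebesgue_measure R, forall x, x \in `]0, l[ -> y 0 x = y0 x} ;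
  sol_init_t :
    {ae @lebesgue_measure R, forall x, x \in `]0, l[ -> y_t 0 x = y1 x} ;
  sol_trace : forall T : R, 0 < T -> in_H1 `]0, T[ (fun t => y t l) z ;
  sol_wave : forall f fx : R -> R, in_Vhalf l f fx ->
    forall phi : R -> R, test_function `]0, +oo[ phi ->
    - (\int[@lebesgue_measure R]_(t in `]0%R, +oo[)
         ((\int[@lebesgue_measure R]_(x in `]0, l[) (y_t t x * f x))
            * (phi^`())%classic t))
    + \int[@lebesgue_measure R]_(t in `]0%R, +oo[)
        ((\int[@lebesgue_measure R]_(x in `]0, l[) (y_x t x * fx x)) * phi t)
    = \int[@lebesgue_measure R]_(t in `]0%R, +oo[)
        (delayed_feedback l mu z t * f l * phi t) }.

Definition energy (R : realType) (l : R) (y_x y_t : R -> R -> R) (t : R) : R :=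
  2^-1 * \int[@lebesgue_measure R]_(x in `]0, l[)
           ((y_x t x) ^+ 2 + (y_t t x) ^+ 2).

(* Main.v *)
(* By d'Alembert, y(x,t) = p(t + x) - p(t - x), and the boundary condition at
   x = l becomes P(s + 4l) = - (1 - mu) P(s + 2l) - mu P(s) for P = p', a
   recursion whose characteristic roots lie in the open unit disc; since
   E(t) is the integral of P^2 over ]t - l, t + l[, the energy decays.

   To extract this from the weak formulation, test the first-order system with
   the polynomials f = (t + x)^n - (t - x)^n and h = (t + x)^n + (t - x)^n,
   which solve the wave equation: then
     d/dt (int_0^l y_t f + y_x h) = (t + l)^n (g + z) + (t - l)^n (z - g),
   where g = y_x(l,.) and z = y_t(l,.).  As f and h are finite sums of products
   of a function of t and a function of x, this follows from the equations for
   the moments int_0^l x^j y_t and int_0^l x^j y_x.  All moments being known, P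
   is determined almost everywhere by g and z.  The decay of the recursion comes
   from a quadratic Lyapunov function. *)

Require Import Defs.
From mathcomp Require Import all_boot all_order all_algebra.
From mathcomp Require Import all_classical all_reals all_analysis.
From mathcomp Require Import measurable_realfun ring lra.

Set Implicit Arguments.
Unset Strict Implicit.
Unset Printing Implicit Defensive.

Import Order.TTheory GRing.Theory Num.Theory.
Import numFieldNormedType.Exports.

Local Open Scope classical_set_scope.
Local Open Scope ring_scope.

(** * Smooth functions *)

Section smooth.
Context {R : realType}.
Implicit Types (f g : R -> R) (n : nat) (x : R).

(** The weak formulation only admits test functions vanishing at [x = 0], and [y_x] has no time
    derivative of its own. Parity resolves both difficulties: [f] contains only odd powers of [x],
    all admissible in [sol_wave], while the moments of [y_x] are rewritten by integration by parts
    in space, which leaves moments of [y] and the trace [y t l], both differentiable in time. The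
    decisive choice is to compare the times [t] and [t + 2 * l]. The windows on which the two
    profiles live are then adjacent and disjoint, so one moment identity identifies P both with the
    wave arriving at [x = l] and with the wave sent back from it. Hence what leaves the end at time
    [s] returns at time [s + 2 * l], and the feedback law closes this into a recursion for one
    scalar function. On []0, 2 * l[] the feedback is off, which ties the second term of the
    recursion to the first, so that the initial energy alone controls everything. The statement
    fixes [M] before the solution. The initial energy must therefore be computed from the data,
    although [y_x 0] is only some weak derivative of a function equal to [y0] almost everywhere. *)

Definition smooth f := forall n x, derivable (derive1n n f) x 1.

(** Differentiability counted order by order, so that closure properties follow by induction: one
    derivative of a product or of an inverse involves the factors at one order less. *)
Fixpoint smoothn n f : Prop :=
  if n is m.+1 then (forall x, derivable f x 1) /\ smoothn m (derive1 f) else True.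

Lemma smoothnP f : (forall n, smoothn n f) -> smooth f.
Proof.
move=> + n; elim: n f => [|n IH] f sf x; first by case: (sf 1%N) => + _; exact.
by rewrite derive1Sn; apply: IH => m; case: (sf m.+1).
Qed.

Lemma smooth_smoothn f n : smooth f -> smoothn n f.
Proof.
elim: n f => [|n IH] f sf; first exact: I.
by split; [exact: (sf 0%N)|apply: IH => m x; rewrite -derive1Sn; exact: sf].
Qed.

Lemma smoothn_is_deriveS n f df :
  (forall x, is_derive x 1 f (df x)) -> smoothn n df -> smoothn n.+1 f.
Proof.
move=> fdf sf; split => [x|]; first exact: ex_derive.
suff -> : derive1 f = df by [].
by apply/funext => x; rewrite derive1E derive_val.
Qed.

Lemma smoothn_derive n f : smoothn n.+1 f -> smoothn n (derive1 f).
Proof. by case. Qed.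

Lemma smoothn_is_derive n f x : smoothn n.+1 f -> is_derive x 1 f ((derive1 f) x).
Proof. by case=> sf _; apply: DeriveDef; [exact: sf|rewrite derive1E]. Qed.

Lemma smoothnW n f : smoothn n.+1 f -> smoothn n f.
Proof.
elim: n f => [|n IH] f; first by move=> _; exact: I.
by case=> sf sf'; split => //; exact: IH.
Qed.

Lemma smooth_derive f : smooth f -> smooth (derive1 f).
Proof. by move=> sf n x; rewrite -derive1Sn; exact: sf. Qed.

Lemma smooth_derivable f x : smooth f -> derivable f x 1.
Proof. by move=> /(_ 0%N x). Qed.

Lemma smooth_is_derive f x : smooth f -> is_derive x 1 f ((derive1 f) x).
Proof. by move=> sf; exact/smoothn_is_derive/(smooth_smoothn 1 sf). Qed.

Lemma smooth_continuous f : smooth f -> continuous f.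
Proof. by move=> sf x; exact/differentiable_continuous/derivable1_diffP/smooth_derivable. Qed.

Lemma smoothnD n f g : smoothn n f -> smoothn n g -> smoothn n (f \+ g).
Proof.
elim: n f g => [|n IH] f g sf sg; first exact: I.
apply: (@smoothn_is_deriveS _ _ ((derive1 f) \+ (derive1 g))).
  move=> x; have := smoothn_is_derive x sf; have := smoothn_is_derive x sg.
  by move=> ? ?; exact: is_deriveD.
by apply: IH; [exact: (smoothn_derive sf)|exact: (smoothn_derive sg)].
Qed.

Lemma smoothnM n f g : smoothn n f -> smoothn n g -> smoothn n (f \* g).
Proof.
elim: n f g => [|n IH] f g sf sg; first exact: I.
apply: (@smoothn_is_deriveS _ _ ((f \* (derive1 g)) \+ (g \* (derive1 f)))).
  move=> x; have := smoothn_is_derive x sf; have := smoothn_is_derive x sg.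
  by move=> ? ?; exact: is_deriveM.
apply: smoothnD; apply: IH.
- exact: (smoothnW sf).
- exact: (smoothn_derive sg).
- exact: (smoothnW sg).
- exact: (smoothn_derive sf).
Qed.

Lemma smoothn_cst n (c : R) : smoothn n (cst c).
Proof.
elim: n c => [|n IH] c; first exact: I.
apply: (@smoothn_is_deriveS _ _ (cst 0)) => // x.
Qed.

Lemma smoothnZ n (c : R) f : smoothn n f -> smoothn n (fun x => c * f x).
Proof. exact/smoothnM/smoothn_cst. Qed.

Lemma smoothn_affine n (a b : R) f :
  smoothn n f -> smoothn n (fun x => f (a * x + b)).
Proof.
elim: n f => [|n IH] f sf; first exact: I.
apply: (@smoothn_is_deriveS _ _ (fun x => a * (derive1 f) (a * x + b))).
  move=> x; have df := smoothn_is_derive (a * x + b) sf.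
  have -> : (fun x => f (a * x + b)) = f \o (fun x => a * x + b) by [].
  rewrite mulrC; apply: is_derive1_comp.
  by apply: is_derive_eq; rewrite addr0 /GRing.scale/= mulr1.
by apply: smoothnZ; apply: IH; exact: (smoothn_derive sf).
Qed.

(** The derivative of [1 / f] is a product of [1 / f], [1 / f] and [f'], so [1 / f] at order [n]
    gives order [n + 1]. *)
Lemma smoothnV n f : (forall x, f x != 0) -> smoothn n f ->
  smoothn n (fun x => (f x)^-1).
Proof.
move=> f0; elim: n => [|n IH] sf; first exact: I.
apply: (@smoothn_is_deriveS _ _
  (fun x => (- 1) * (((f x)^-1 * (f x)^-1) * (derive1 f) x))).
  move=> x; have df := smoothn_is_derive x sf.
  apply: is_derive_eq (is_deriveV (f0 x) df) _.
  by rewrite /GRing.scale/= -exprVn mulN1r mulNr expr2.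
apply: smoothnZ; apply: (@smoothnM _ (fun x => _ * _)); last exact: (smoothn_derive sf).
by apply: (@smoothnM _ (fun x => _^-1) (fun x => _^-1)); apply: IH; exact: (smoothnW sf).
Qed.

Lemma smoothD f g : smooth f -> smooth g -> smooth (f \+ g).
Proof.
move=> sf sg; apply: smoothnP => n.
by apply: smoothnD; [exact: (smooth_smoothn n sf)|exact: (smooth_smoothn n sg)].
Qed.

Lemma smoothM f g : smooth f -> smooth g -> smooth (f \* g).
Proof.
move=> sf sg; apply: smoothnP => n.
by apply: smoothnM; [exact: (smooth_smoothn n sf)|exact: (smooth_smoothn n sg)].
Qed.

Lemma smooth_cst (c : R) : smooth (cst c).
Proof. by apply: smoothnP => n; exact: smoothn_cst. Qed.

Lemma smooth_affine (a b : R) f : smooth f -> smooth (fun x => f (a * x + b)).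
Proof. by move=> sf; apply: smoothnP => n; apply: smoothn_affine; exact: smooth_smoothn. Qed.

Lemma smoothV f : (forall x, f x != 0) -> smooth f -> smooth (fun x => (f x)^-1).
Proof. by move=> f0 sf; apply: smoothnP => n; apply: smoothnV => //; exact: smooth_smoothn. Qed.

Lemma smooth_exp n : smooth (fun x => x ^+ n).
Proof.
elim: n => [|n IH]; first exact: smooth_cst.
have -> : (fun x => x ^+ n.+1) = (fun x => x) \* (fun x => x ^+ n).
  by apply/funext => x; rewrite exprS.
apply: smoothM => //; apply: smoothnP => -[|k]; first exact: I.
by apply: (@smoothn_is_deriveS _ _ (cst 1)) => //; exact: smoothn_cst.
Qed.

(* The family is stable under differentiation, since the derivative of
   [x^-n exp(-1/x)] is [x^-(n+2) exp(-1/x) - n x^-(n+1) exp(-1/x)]. *)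
Definition flat n x := if 0 < x then x ^- n * expR (- x^-1) else 0.

Lemma flatE n x : 0 < x -> flat n x = x ^- n * expR (- x^-1).
Proof. by rewrite /flat => ->. Qed.

Lemma flat0 n x : x <= 0 -> flat n x = 0.
Proof. by rewrite /flat leNgt => /negbTE ->. Qed.

Lemma flat_ge0 n x : 0 <= flat n x.
Proof.
rewrite /flat; case: ifPn => // x0.
by rewrite mulr_ge0 ?expR_ge0// invr_ge0 exprn_ge0// ltW.
Qed.

Lemma flat_gt0 n x : 0 < x -> 0 < flat n x.
Proof. by move=> x0; rewrite flatE// mulr_gt0 ?expR_gt0// invr_gt0 exprn_gt0. Qed.

(** One term of the exponential series at [1 / x] already dominates the power [x ^- n.+1]. With
    [flatS] this makes the family flat at 0. *)
Lemma flat_le n x : flat n.+1 x <= n.+1`!%:R.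
Proof.
rewrite /flat; case: ifPn => // x0.
rewrite expRN -exprVn ler_pdivrMr ?expR_gt0//.
have := @expR_ge1Dxn R x^-1 n (ltW _); rewrite invr_gt0 => /(_ x0) h.
rewrite -ler_pdivrMl ?ltr0n ?fact_gt0//.
by apply: le_trans h; rewrite mulrC ler_wpDl.
Qed.

Lemma flatS n x : flat n x = x * flat n.+1 x.
Proof.
rewrite /flat; case: ifPn => [x0|_]; last by rewrite mulr0.
by rewrite exprS invfM !mulrA divff ?mul1r// gt_eqF.
Qed.

Lemma is_derive_flat n x :
  is_derive x 1 (flat n) (flat n.+2 x - n%:R * flat n.+1 x).
Proof.
have [x0|x0|->] := ltgtP x 0.
- rewrite !flat0 ?ltW// mulr0 subr0.
  apply: (@near_eq_is_derive R R R (cst 0)) => //.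
  by near=> y; rewrite flat0//; apply/ltW; near: y; exact: lt_nbhsl.
- rewrite !flatE//.
  apply: (@near_eq_is_derive R R R (fun y => y ^- n * expR (- y^-1))).
    by near=> y; rewrite [RHS]flatE//; near: y; exact: lt_nbhsr.
  have xn0 : x != 0 by rewrite gt_eqF.
  have dV : is_derive x 1 (fun y : R => y^-1) (- x ^- 2).
    by apply: is_derive_eq (is_deriveV xn0 (is_derive_id x 1)) _; rewrite /GRing.scale/= mulr1.
  have dVn : is_derive x 1 (fun y : R => y ^- n) (- (n%:R * x ^- n.+1)).
    have -> : (fun y : R => y ^- n) = (fun y : R => y^-1) ^+ n.
      by apply/funext => y; rewrite exprfctE exprVn.
    apply: is_derive_eq (is_deriveX n dV) _.
    case: n => [|n]; first by rewrite !mul0r scale0r oppr0.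
    by rewrite /GRing.scale/= mulrN -!exprVn -mulrA -exprD addn2.
  have dN : is_derive x 1 (fun y : R => - y^-1) (x ^- 2).
    by apply: is_derive_eq (is_deriveN dV) _; rewrite opprK.
  apply: is_derive_eq (is_deriveM dVn (is_derive1_comp (is_derive_expR _) dN)) _.
  rewrite /GRing.scale/= -!exprVn !exprS; ring.
- rewrite !flat0// mulr0 subr0.
  (* At 0 the difference quotient is [flat n.+1 h = h * flat n.+2 h], which is at most
     [|h| * n.+2!]. *)
  have key : (fun h : R => h^-1 *: ((flat n \o shift 0) (h *: 1) - flat n 0)) @ 0^' --> (0 : R).
    apply/cvgrPdist_le => /= e e0; near=> h.
    rewrite sub0r normrN (@flat0 _ 0 (lexx 0)) subr0 /= addr0 /GRing.scale/= mulr1.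
    have h0 : h != 0 by near: h; exact: nbhs_dnbhs_neq.
    rewrite flatS mulrA mulVf// mul1r flatS normrM.
    apply: (@le_trans _ _ (`|h| * n.+2`!%:R)).
      by rewrite ler_wpM2l// ger0_norm ?flat_ge0// flat_le.
    rewrite -ler_pdivlMr ?ltr0n ?fact_gt0//.
    near: h; apply: dnbhs0_le; rewrite divr_gt0// ltr0n fact_gt0//.
  apply: DeriveDef; first by apply/cvg_ex; exists 0.
  by apply/cvg_lim => //.
Unshelve. all: by end_near. Qed.

Lemma smooth_flat n : smooth (flat n).
Proof.
apply: smoothnP => k; elim: k n => [|k IH] n; first exact: I.
apply: (smoothn_is_deriveS (is_derive_flat n)).
apply: (@smoothnD _ _ (fun x => - (n%:R * flat n.+1 x))) => //.
have -> : (fun x => - (n%:R * flat n.+1 x)) = (fun x => - n%:R * flat n.+1 x).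
  by apply/funext => x; rewrite mulNr.
exact: smoothnZ.
Qed.

(** The usual smooth transition from 0 to 1. The denominator never vanishes because [x] and [1 - x]
    are not both nonpositive. *)
Definition step x := flat 0 x * (flat 0 x + flat 0 (1 - x))^-1.

Lemma step_denom_gt0 x : 0 < flat 0 x + flat 0 (1 - x).
Proof.
have [x0|x0] := ltP 0 x; first by rewrite ltr_pwDl ?flat_ge0 ?flat_gt0.
by rewrite ltr_wpDl ?flat_ge0 ?flat_gt0// subr_gt0 (le_lt_trans x0).
Qed.

Lemma smooth_step : smooth step.
Proof.
apply: (@smoothM _ (fun x => _^-1)); first exact: smooth_flat.
apply: smoothV => [x|]; first by rewrite gt_eqF// step_denom_gt0.
apply: (@smoothD _ (fun x => flat 0 (1 - x))); first exact: smooth_flat.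
have -> : (fun x => flat 0 (1 - x)) = (fun x => flat 0 (- 1 * x + 1)).
  by apply/funext => x; rewrite mulN1r addrC.
exact/smooth_affine/smooth_flat.
Qed.

Lemma step0 x : x <= 0 -> step x = 0.
Proof. by move=> x0; rewrite /step flat0// mul0r. Qed.

Lemma step1 x : 1 <= x -> step x = 1.
Proof.
move=> x1; rewrite /step (@flat0 _ (1 - x)) ?subr_le0// addr0 divff//.
by rewrite gt_eqF// flat_gt0// (lt_le_trans _ x1).
Qed.

Lemma step_ge0 x : 0 <= step x.
Proof. by rewrite divr_ge0 ?flat_ge0// ltW// step_denom_gt0. Qed.

Lemma step_le1 x : step x <= 1.
Proof. by rewrite ler_pdivrMr ?step_denom_gt0// mul1r lerDl flat_ge0. Qed.

(** Monotonicity turns the derivative of a rescaled step into a nonnegative kernel of integral 1,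
    which is how it is used in [ramp_average]. *)
Lemma derive1_step_ge0 x : 0 <= (derive1 step) x.
Proof.
have d1 := is_derive_flat 0 x.
have d2 : is_derive x 1 (fun x => flat 0 (1 - x)) (- flat 2 (1 - x)).
  have := is_derive_flat 0 (1 - x) => d.
  have -> : (fun x => flat 0 (1 - x)) = flat 0 \o (fun x => 1 - x) by [].
  rewrite -mulrN1 -[flat 2 _]subr0 -(mul0r (flat 1 (1 - x))).
  apply: is_derive1_comp.
  by have := is_deriveB (is_derive_cst (1 : R) x 1) (is_derive_id x 1); rewrite sub0r.
have n0 : flat 0 x + flat 0 (1 - x) != 0 by rewrite gt_eqF// step_denom_gt0.
have dV : is_derive x 1 (fun x => (flat 0 x + flat 0 (1 - x))^-1)
   (- (flat 0 x + flat 0 (1 - x)) ^- 2 * (flat 2 x - flat 2 (1 - x))).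
  have dD : is_derive x 1 (fun x => flat 0 x + flat 0 (1 - x)) _ := is_deriveD d1 d2.
  apply: is_derive_eq (@is_deriveV _ (fun x => flat 0 x + flat 0 (1 - x)) _ _ _ n0 dD) _.
  by rewrite /GRing.scale/= mul0r subr0.
have -> : (derive1 step) x = (flat 0 x + flat 0 (1 - x)) ^- 2 *
    (flat 2 x * flat 0 (1 - x) + flat 0 x * flat 2 (1 - x)).
  rewrite derive1E; apply: derive_val; apply: is_derive_eq (is_deriveM d1 dV) _.
  rewrite /GRing.scale/= mul0r subr0; field.
  by [].
rewrite mulr_ge0// ?addr_ge0 ?mulr_ge0 ?flat_ge0//.
by rewrite invr_ge0 exprn_ge0// ltW// step_denom_gt0.
Qed.

Lemma derive1_step_outside x : ~~ (0 <= x <= 1) -> (derive1 step) x = 0.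
Proof.
rewrite negb_and -!ltNge => /orP[x0|x1]; rewrite derive1E.
  have nx : \near x, step x = cst 0 x.
    by near=> y; rewrite step0//; apply/ltW; near: y; exact: lt_nbhsl.
  by rewrite (@near_eq_derive R R R _ (cst 0) _ _ nx) derive_cst.
have nx : \near x, step x = cst 1 x.
  by near=> y; rewrite step1//; apply/ltW; near: y; exact: lt_nbhsr.
by rewrite (@near_eq_derive R R R _ (cst 1) _ _ nx) derive_cst.
Unshelve. all: by end_near. Qed.

Lemma smooth_affine_exp (a b : R) n : smooth (fun x => (a * x + b) ^+ n).
Proof. exact: (@smooth_affine a b _ (@smooth_exp n)). Qed.

End smooth.

(** * Lebesgue integral on the line *)

Section integral_tools.
Context {R : realType}.
Notation mu := (@lebesgue_measure R).
Implicit Types (a b : R) (f g df u v : R -> R).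

Lemma Rintegral_dominated_cvg (D : set (measurableTypeR R)) (f_ : nat -> R -> R) f g :
  measurable D -> (forall n, measurable_fun D (f_ n)) -> measurable_fun D f ->
  {ae mu, forall x, D x -> f_ ^~ x @ \oo --> f x} ->
  mu.-integrable D (EFin \o g) -> (forall n x, D x -> `|f_ n x| <= g x) ->
  \int[mu]_(x in D) f_ n x @[n --> \oo] --> \int[mu]_(x in D) f x.
Proof.
move=> mD mf_ mf ff ig fg.
have ff' : {ae mu, forall x, D x -> (f_ n x)%:E @[n --> \oo] --> (f x)%:E}.
  apply: filterS ff => x ffx Dx.
  by apply: cvg_EFin; [exact: nearW|exact: ffx].
have fg' : {ae mu, forall x n, D x -> (`|(f_ n x)%:E| <= (g x)%:E)%E}.
  by apply: aeW => x n Dx; rewrite /= lee_fin; exact: fg.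
have mf_' n := (@measurable_EFinP _ (measurableTypeR R) R D (f_ n)).2 (mf_ n).
have mf' := (@measurable_EFinP _ (measurableTypeR R) R D f).2 mf.
have [fi _ h] := dominated_convergence mD mf_' mf' ff' ig fg'.
by apply: fine_cvg; rewrite fineK//; exact: integrable_fin_num.
Qed.

Lemma eq_integrableR (D : set (measurableTypeR R)) f g : measurable D -> {in D, f =1 g} ->
  mu.-integrable D (EFin \o f) -> mu.-integrable D (EFin \o g).
Proof. by move=> mD fg; apply: eq_integrable => // x xD; rewrite /= fg. Qed.

Lemma integrable_patch (D : set (measurableTypeR R)) f : measurable D ->
  mu.-integrable D (EFin \o f) <-> mu.-integrable setT (EFin \o (f \_ D)).
Proof. by move=> mD; rewrite -restrict_EFin; exact: integrable_mkcond. Qed.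

Lemma integrableR_measurable (D : set (measurableTypeR R)) f :
  mu.-integrable D (EFin \o f) -> measurable_fun D f.
Proof. by move=> /integrableP[/measurable_EFinP]. Qed.

Lemma integrableRD (D : set (measurableTypeR R)) f g : measurable D ->
  mu.-integrable D (EFin \o f) -> mu.-integrable D (EFin \o g) ->
  mu.-integrable D (EFin \o (fun x => f x + g x)).
Proof. by move=> mD fi gi; exact: (integrableD mD fi gi). Qed.

Lemma integrableRZ (D : set (measurableTypeR R)) f (k : R) : measurable D ->
  mu.-integrable D (EFin \o f) -> mu.-integrable D (EFin \o (fun x => k * f x)).
Proof. by move=> mD fi; apply: (integrableZl mD k fi). Qed.

Lemma integrableRN (D : set (measurableTypeR R)) f : measurable D ->
  mu.-integrable D (EFin \o f) -> mu.-integrable D (EFin \o (fun x => - f x)).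
Proof. by move=> mD fi; apply: (integrableN fi). Qed.

Lemma integrableRB (D : set (measurableTypeR R)) f g : measurable D ->
  mu.-integrable D (EFin \o f) -> mu.-integrable D (EFin \o g) ->
  mu.-integrable D (EFin \o (fun x => f x - g x)).
Proof. by move=> mD fi gi; apply: (integrableRD mD fi (integrableRN mD gi)). Qed.

Lemma within_continuous_integrable a b f : {within `[a, b], continuous f} ->
  mu.-integrable `]a, b[ (EFin \o f).
Proof.
move=> cf; apply: (@integrableS _ _ _ mu `[a, b]) => //.
  exact: subset_itv_oo_cc.
by apply: continuous_compact_integrable => //; exact: segment_compact.
Qed.

Lemma within_continuousM a b f g : {within `[a, b], continuous f} ->
  {within `[a, b], continuous g} -> {within `[a, b], continuous (fun x => f x * g x)}.
Proof. by move=> cf cg x; apply: continuousM; [exact: cf|exact: cg]. Qed.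

Lemma within_continuousD a b f g : {within `[a, b], continuous f} ->
  {within `[a, b], continuous g} -> {within `[a, b], continuous (fun x => f x + g x)}.
Proof. by move=> cf cg x; exact: (cvgD (cf x) (cg x)). Qed.

Lemma within_continuous_bounded a b f : {within `[a, b], continuous f} ->
  exists2 M : R, 0 < M & forall x, a <= x <= b -> `|f x| <= M.
Proof.
move=> cf; have cab := @segment_compact R a b.
have /compact_bounded[M [_ Mf]] := continuous_compact cf cab.
exists (`|M| + 1) => [|x xab]; first by rewrite ltr_wpDl.
apply: (Mf (`|M| + 1)); first by rewrite (le_lt_trans (ler_norm M))// ltrDl.
by exists x.
Qed.

Lemma integrable_mul_continuous a b f g : mu.-integrable `]a, b[ (EFin \o f) ->
  {within `[a, b], continuous g} ->
  mu.-integrable `]a, b[ (EFin \o (fun x => f x * g x)).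
Proof.
move=> fi cg; have [M M0 gM] := within_continuous_bounded cg.
apply: (@integrableMl _ _ _ mu `]a, b[ _ (EFin \o f) g) => //.
  apply: (@measurable_funS _ _ _ _ `[a, b]) => //; first exact: subset_itv_oo_cc.
  exact: subspace_continuous_measurable_fun.
exists M; split; first exact: num_real.
move=> N MN x /= xab; apply: le_trans (ltW MN); apply: gM.
by move: xab; rewrite in_itv/= => /andP[? ?]; rewrite !ltW.
Qed.

Lemma Rintegral_itv_oo_cc a b f : mu.-integrable `]a, b[ (EFin \o f) ->
  \int[mu]_(x in `]a, b[) f x = \int[mu]_(x in `[a, b]) f x.
Proof.
move=> fi; congr fine; apply/esym/integral_itv_bndoo; exact: (measurable_int mu).
Qed.

Lemma within_continuous_derivable_oo_LRcontinuous a b f df : a < b ->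
  {within `[a, b], continuous f} ->
  (forall x, a < x < b -> is_derive x 1 f (df x)) ->
  derivable_oo_LRcontinuous f a b.
Proof.
move=> ab /(continuous_within_itvP _ ab)[_ fa fb] fdf; split => // x.
by rewrite in_itv/= => /fdf ?; exact: ex_derive.
Qed.

Lemma FTC2_oo a b f df : a < b ->
  {within `[a, b], continuous f} -> {within `[a, b], continuous df} ->
  (forall x, a < x < b -> is_derive x 1 f (df x)) ->
  \int[mu]_(x in `]a, b[) df x = f b - f a.
Proof.
move=> ab cf cdf fdf.
rewrite Rintegral_itv_oo_cc; last exact: within_continuous_integrable.
rewrite /Rintegral (@continuous_FTC2 _ df f)//.
  exact: within_continuous_derivable_oo_LRcontinuous cf fdf.
by move=> x; rewrite in_itv/= derive1E => /fdf ?; rewrite derive_val.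
Qed.

Lemma Rintegral_sum (D : set (measurableTypeR R)) n (f : nat -> R -> R) : measurable D ->
  (forall i, mu.-integrable D (EFin \o f i)) ->
  mu.-integrable D (EFin \o (fun x => \sum_(i < n) f i x)) /\
  \int[mu]_(x in D) (\sum_(i < n) f i x) = \sum_(i < n) \int[mu]_(x in D) f i x.
Proof.
move=> mD fi; elim: n => [|n [IHi IH]].
  rewrite big_ord0 (_ : (fun x => _) = cst 0); last by apply/funext => x; rewrite big_ord0.
  by split; [exact: integrable0|rewrite Rintegral_cst// mul0r].
rewrite (_ : (fun x => _) = (fun x => \sum_(i < n) f i x + f n x)); last first.
  by apply/funext => x; rewrite big_ord_recr.
by rewrite RintegralD// IH big_ord_recr/=; split => //; exact: integrableRD.
Qed.

Lemma ae_eq_Rintegral (D : set (measurableTypeR R)) (f h : R -> R) : measurable D ->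
  measurable_fun D h -> mu.-integrable D (EFin \o f) ->
  {ae mu, forall x, D x -> f x = h x} ->
  mu.-integrable D (EFin \o h) /\ \int[mu]_(x in D) f x = \int[mu]_(x in D) h x.
Proof.
move=> mD mh fi fh; have mf := integrableR_measurable fi.
have mh' := (@measurable_EFinP _ (measurableTypeR R) R D h).2 mh.
have mf' := (@measurable_EFinP _ (measurableTypeR R) R D f).2 mf.
split; last first.
  by congr fine; apply: ae_eq_integral => //; apply: filterS fh => x fhx Dx; rewrite /= fhx.
apply/integrableP; split => //; move/integrableP: fi => [_]; apply: le_lt_trans.
rewrite le_eqVlt; apply/orP; left; apply/eqP; apply: ae_eq_integral => //.
- exact: measurableT_comp.
- exact: measurableT_comp.
- by apply: filterS fh => x fhx Dx; rewrite /= fhx.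
Qed.

Lemma ae_le_Rintegral (D : set (measurableTypeR R)) (f h : R -> R) : measurable D ->
  mu.-integrable D (EFin \o f) -> mu.-integrable D (EFin \o h) ->
  {ae mu, forall x, D x -> f x <= h x} ->
  \int[mu]_(x in D) f x <= \int[mu]_(x in D) h x.
Proof.
move=> mD fi hi fh.
(* Replacing [h] by [f \max h], which agrees with it almost everywhere, makes the inequality hold at
   every point. *)
have mm : measurable_fun D (f \max h).
  by apply: measurable_maxr; exact: integrableR_measurable.
have [mi ->] : mu.-integrable D (EFin \o (f \max h)) /\
    \int[mu]_(x in D) h x = \int[mu]_(x in D) (f \max h) x.
  have FF := ae_filter_ringOfSetsType mu.
  apply: ae_eq_Rintegral => //; apply: filterS fh => x fhx Dx.
  by rewrite /= max_r// fhx.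
by apply: le_Rintegral => // x _; rewrite /= le_max lexx.
Qed.

Lemma le_Rintegral_cover (a b c t s : R) (f : R -> R) : (forall x, 0 <= f x) ->
  a <= t -> s <= c -> mu.-integrable `]t, s[ (EFin \o f) ->
  mu.-integrable `]a, b[ (EFin \o f) -> mu.-integrable `]b, c[ (EFin \o f) ->
  \int[mu]_(x in `]t, s[) f x <= \int[mu]_(x in `]a, b[) f x + \int[mu]_(x in `]b, c[) f x.
Proof.
move=> f0 at_ sc i1 i2 i3.
rewrite Rintegral_mkcond [X in X + _]Rintegral_mkcond [X in _ + X]Rintegral_mkcond.
have j1 := (integrable_patch f (measurable_itv `]t, s[)).1 i1.
have j2 := (integrable_patch f (measurable_itv `]a, b[)).1 i2.
have j3 := (integrable_patch f (measurable_itv `]b, c[)).1 i3.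
rewrite -RintegralD//; apply: ae_le_Rintegral => //; first exact: integrableRD.
(* The common endpoint [b] belongs to neither of the two covering intervals. *)
exists [set b]; split; [exact: measurable_set1|exact: lebesgue_measure_set1|].
move=> x /=; apply: contra_notP => xb _.
rewrite !patchE !mem_setE !in_itv/=.
have [xlb|xgb|//] := ltgtP x b.
  rewrite andbT /= addr0; case: ifPn => [/andP[tx _]|_]; last by case: ifP.
  by rewrite (le_lt_trans at_ tx).
rewrite andbF /= add0r; case: ifPn => [/andP[_ xs]|_]; last by case: ifP.
by rewrite (lt_le_trans xs sc).
Qed.

End integral_tools.

(** * Test functions *)

Section test_functions.
Context {R : realType}.
Notation mu := (@lebesgue_measure R).
Implicit Types (Om : set R) (phi f df u v : R -> R).

Lemma test_function_smooth Om phi : test_function Om phi -> smooth phi.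
Proof. by case. Qed.

(** The complement of the closed support is open, so [phi] vanishes in a neighborhood of [x] and its
    derivative vanishes too. *)
Lemma test_function_outside Om phi x : test_function Om phi -> ~ Om x ->
  phi x = 0 /\ derive1 phi x = 0.
Proof.
move=> [_ _ sub] Omx; have : ~ closure [set x | phi x != 0] x by move/sub.
move=> ncl; have : \near x, ~ (phi x != 0).
  apply: contrapT => nn; apply: ncl => B Bx.
  apply: contrapT => /set0P/negP/negPn/eqP B0; apply: nn.
  apply: filterS Bx => y By py.
  by suff : set0 y by []; rewrite -B0.
move=> near0; have nx : \near x, phi x = cst 0 x.
  by near=> y; apply/eqP/negPn/negP; near: y.
split; first by have := nbhs_singleton nx.
by rewrite derive1E (@near_eq_derive R R R _ (cst 0) _ _ nx) derive_cst.
Unshelve. all: by end_near. Qed.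

Lemma test_function_sub Om Om' phi : Om `<=` Om' ->
  test_function Om phi -> test_function Om' phi.
Proof. by move=> OmOm' [sp cp sub]; split => //; exact: subset_trans OmOm'. Qed.

Lemma test_functionM Om phi f : test_function Om phi -> smooth f ->
  test_function Om (fun x => f x * phi x).
Proof.
move=> [sp cp sub] sf.
have cl : closure [set x | f x * phi x != 0] `<=` closure [set x | phi x != 0].
  by apply: closureS => x /=; rewrite mulf_eq0 negb_or => /andP[].
split; first exact: (smoothM sf sp).
  by apply: subclosed_compact cl => //; exact: closed_closure.
exact: subset_trans cl sub.
Qed.

Lemma test_function_itv a b c d phi : smooth phi -> a < c -> d < b ->
  (forall x, ~~ (c <= x <= d) -> phi x = 0) -> test_function `]a, b[ phi.
Proof.
move=> sp ac db phi0.
have cl : closure [set x | phi x != 0] `<=` `[c, d].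
  rewrite [X in _ `<=` X](_ : _ = closure `[c, d]%classic).
    apply: closureS => x /=; apply: contraNT; rewrite in_itv/= => /phi0 ->.
    by rewrite eqxx.
  exact/closure_id/itv_closed.
split => //; first by apply: subclosed_compact cl; [exact: closed_closure|exact: segment_compact].
apply: (subset_trans cl) => x /=; rewrite !in_itv/= => /andP[cx xd].
by rewrite (lt_le_trans ac)// (le_lt_trans xd).
Qed.

Lemma smooth_within_continuous a b f : smooth f -> {within `[a, b], continuous f}.
Proof. by move=> sf; apply: continuous_subspaceT; exact: smooth_continuous. Qed.

Lemma test_function_by_parts a b phi f df : a < b -> test_function `]a, b[ phi ->
  {within `[a, b], continuous f} -> {within `[a, b], continuous df} ->
  (forall x, a < x < b -> is_derive x 1 f (df x)) ->
  \int[mu]_(x in `]a, b[) (f x * derive1 phi x) =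
  - \int[mu]_(x in `]a, b[) (df x * phi x).
Proof.
move=> ab tphi cf cdf fdf; have sphi := test_function_smooth tphi.
have cphi := @smooth_within_continuous a b _ sphi.
have cphi' := @smooth_within_continuous a b _ (smooth_derive sphi).
have i1 := within_continuous_integrable (within_continuousM cf cphi').
have i2 := within_continuous_integrable (within_continuousM cdf cphi).
apply/eqP; rewrite -addr_eq0 -RintegralD//; apply/eqP.
have out x : ~ `]a, b[%classic x -> phi x = 0.
  by move=> /(test_function_outside tphi)[].
transitivity (f b * phi b - f a * phi a); last first.
  by rewrite !out/= ?in_itv/= ?ltxx ?andbF// !mulr0 subr0.
apply: (@FTC2_oo _ _ _ (fun x => f x * phi x)) => //.
- exact: within_continuousM.
- by apply: within_continuousD; exact: within_continuousM.
- move=> x xab; have d1 := fdf _ xab; have d2 := smooth_is_derive x sphi.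
  by apply: is_derive_eq (is_deriveM d1 d2) _; rewrite /GRing.scale/= [phi x * _]mulrC.
Qed.

End test_functions.

(** * Translations and reflections of the Lebesgue measure *)

Section measure_preserving.
Context {R : realType}.
Notation mu := (@lebesgue_measure R).
Notation T := (measurableTypeR R).
Implicit Types (f : R -> R) (h : T -> T) (c : R).

Definition preserves_lebesgue h :=
  measurable_fun setT h /\ forall A : set T, measurable A -> mu (h @^-1` A) = mu A.

Lemma preserves_lebesgue_comp h1 h2 : preserves_lebesgue h1 -> preserves_lebesgue h2 ->
  preserves_lebesgue (h1 \o h2).
Proof.
move=> [m1 p1] [m2 p2]; split; first exact: measurableT_comp.
move=> A mA; rewrite comp_preimage p2 ?p1//.
by rewrite -[X in measurable X]setTI; exact: m1.
Qed.

Lemma preserves_lebesgue_opp : preserves_lebesgue -%R.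
Proof. by split => [|A mA]; [exact: oppr_measurable|exact: lebesgue_measureN]. Qed.

Lemma preserves_lebesgue_shift c : preserves_lebesgue (fun x => x + c).
Proof.
have mc : measurable_fun setT ((fun x => x + c) : T -> T).
  by apply: measurable_funD => //; exact: measurable_cst.
split => // A mA.
rewrite -[LHS]/(pushforward mu ((fun x => x + c) : T -> T) A).
apply/esym/lebesgue_measure_unique => //= _ [[a b]] _ <-.
rewrite /pushforward/=.
rewrite (_ : _ @^-1` _ = `]a - c, b - c]%classic); last first.
  by apply/seteqP; split => x /=; rewrite !in_itv/= ltrBlDr lerBrDr.
rewrite !lebesgue_measure_itv/= !lte_fin ltrD2r.
by case: ifP => // _; rewrite -!EFinD; congr (_%:E); ring.
Qed.

Lemma preserves_lebesgue_reflect c : preserves_lebesgue (fun x => c - x).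
Proof.
have := preserves_lebesgue_comp (preserves_lebesgue_shift c) preserves_lebesgue_opp.
by rewrite (_ : _ \o _ = fun x => c - x)//; apply/funext => x /=; rewrite addrC.
Qed.

Lemma preserves_lebesgue_ge0_integral h (f : R -> \bar R) : preserves_lebesgue h ->
  measurable_fun (setT : set T) f -> (forall x, (0 <= f x)%E) ->
  (\int[mu]_x f (h x) = \int[mu]_x f x)%E.
Proof.
move=> [mh ph] mf f0.
rewrite -(@ge0_integral_pushforward _ _ _ _ _ h mh mu setT f)//.
by apply: eq_measure_integral => A mA _; exact: ph.
Qed.

Lemma preserves_lebesgue_integrable h f : preserves_lebesgue h ->
  mu.-integrable setT (EFin \o f) -> mu.-integrable setT (EFin \o (f \o h)).
Proof.
move=> ph /integrableP[mf fi]; apply/integrableP; split.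
  by apply: (measurableT_comp mf); case: ph.
rewrite (@preserves_lebesgue_ge0_integral h (fun x => `|(f x)%:E|%E))//.
exact: measurableT_comp.
Qed.

Lemma preserves_lebesgue_Rintegral h f : preserves_lebesgue h ->
  mu.-integrable setT (EFin \o f) -> \int[mu]_x f (h x) = \int[mu]_x f x.
Proof.
move=> ph fi; congr fine.
have [mh pm] := ph.
have := @integral_pushforward _ _ _ _ _ h mh mu setT (EFin \o f) (measurable_int mu fi)
  (preserves_lebesgue_integrable ph fi) measurableT.
rewrite preimage_setT => <-.
by apply: eq_measure_integral => A mA _; exact: pm.
Qed.

Lemma preserves_lebesgue_ae h (P : R -> Prop) : preserves_lebesgue h ->
  {ae mu, forall x, P x} -> {ae mu, forall x, P (h x)}.
Proof.
move=> [mh pm] [N [mN N0 PN]]; exists (h @^-1` N); split.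
- by rewrite -[X in measurable X]setTI; exact: mh.
- by rewrite pm.
- by move=> x /= nP; exact: PN.
Qed.

Lemma Rintegral_itv_shift (a b c : R) (f : R -> R) : mu.-integrable `]a, b[ (EFin \o f) ->
  mu.-integrable `]a - c, b - c[ (EFin \o (fun s => f (s + c))) /\
  \int[mu]_(s in `]a - c, b - c[) f (s + c) = \int[mu]_(s in `]a, b[) f s.
Proof.
move=> fi; have E : (fun s => f (s + c)) \_ `]a - c, b - c[ = (f \_ `]a, b[) \o (fun s => s + c).
  by apply/funext => s; rewrite /= !patchE !mem_setE !in_itv/= ltrBlDr ltrBrDr.
have fi' := (integrable_patch f (measurable_itv `]a, b[)).1 fi.
split.
  apply: (integrable_patch _ (measurable_itv _)).2; rewrite E.
  exact: preserves_lebesgue_integrable (preserves_lebesgue_shift c) fi'.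
rewrite Rintegral_mkcond E [RHS]Rintegral_mkcond.
exact: (preserves_lebesgue_Rintegral (preserves_lebesgue_shift c) fi').
Qed.

End measure_preserving.

(** * Square-integrable functions and their pairing *)

Section square_integrable.
Context {R : realType}.
Notation mu := (@lebesgue_measure R).
Implicit Types (a b k : R) (f g d h u v : R -> R) (Om : set (measurableTypeR R)).

Lemma in_L2_measurable Om f : measurable Om -> in_L2 Om f -> measurable_fun Om f.
Proof.
by move=> mOm; rewrite /in_L2 inE => /andP[+ _]; rewrite inE/= => /(measurable_restrictT _ mOm).2.
Qed.

Lemma in_L2_sqr_integrable Om f : measurable Om -> in_L2 Om f ->
  mu.-integrable Om (EFin \o (fun x => f x ^+ 2)).
Proof.
move=> mOm /Lfun2_integrable_sqr fi; apply/integrable_patch => //.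
apply: eq_integrableR fi => // x _.
by rewrite /= !patchE; case: ifP => //; rewrite expr0n.
Qed.

Lemma in_L2P Om f : measurable Om -> measurable_fun Om f ->
  mu.-integrable Om (EFin \o (fun x => f x ^+ 2)) -> in_L2 Om f.
Proof.
move=> mOm mf fi; rewrite /in_L2 inE; apply/andP; split; rewrite inE/=.
  exact: (measurable_restrictT f mOm).1.
rewrite /finite_norm unlock poweR_lty//.
move/integrableP: ((integrable_patch (fun x => f x ^+ 2) mOm).1 fi) => [_].
apply: le_lt_trans; rewrite le_eqVlt; apply/orP; left; apply/eqP.
apply: eq_integral => x _ /=; congr (_%:E).
rewrite powR_mulrn// -normrX !patchE; case: ifP => // _.
by rewrite expr0n.
Qed.

Lemma in_L2_integrable a b f : in_L2 `]a, b[ f -> mu.-integrable `]a, b[ (EFin \o f).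
Proof.
move=> f2; have mf := in_L2_measurable (measurable_itv _) f2.
(* On a bounded interval [1 + f ^+ 2] is integrable, and it dominates [|f|]. *)
have i1 : mu.-integrable `]a, b[ (EFin \o (fun x => 1 + f x ^+ 2)).
  apply: integrableRD => //; last exact: in_L2_sqr_integrable.
  by apply: within_continuous_integrable => x; exact: cvg_cst.
apply: le_integrable i1 => //; first exact/measurable_EFinP.
move=> x _ /=; rewrite lee_fin [leRHS]ger0_norm; last by rewrite addr_ge0// sqr_ge0.
by rewrite -real_normK ?num_real//; set y := `|_|; nra.
Qed.

Lemma in_L2B Om f g : in_L2 Om f -> in_L2 Om g -> in_L2 Om (f \- g).
Proof.
rewrite /in_L2 => f2 g2.
have -> : (f \- g) \_ Om = (-1 *: (g \_ Om) + f \_ Om : R -> R).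
  apply/funext => x; rewrite [RHS]/= !fctE !patchE /GRing.scale/= mulN1r.
  by case: ifP => //= _; rewrite ?oppr0 ?addr0 1?addrC.
have le12 : (1 <= 2%:E :> \bar R)%E by rewrite lee_fin ler1n.
exact: ((Lfun_submod_closed mu le12).2).
Qed.

Lemma in_L2Z Om k f : in_L2 Om f -> in_L2 Om (fun x => k * f x).
Proof.
rewrite /in_L2 => f2.
have -> : (fun x => k * f x) \_ Om = (k *: (f \_ Om) + 0 : R -> R).
  apply/funext => x; rewrite addr0 !fctE !patchE /GRing.scale/=.
  by case: ifP => //= _; rewrite mulr0.
have le12 : (1 <= 2%:E :> \bar R)%E by rewrite lee_fin ler1n.
apply: ((Lfun_submod_closed mu le12).2) => //.
exact: ((Lfun_submod_closed mu le12).1).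
Qed.

Lemma continuous_in_L2 a b h : {within `[a, b], continuous h} -> in_L2 `]a, b[ h.
Proof.
move=> ch; apply: in_L2P => //.
  exact: (integrableR_measurable (within_continuous_integrable ch)).
by apply: within_continuous_integrable; exact: within_continuousM.
Qed.

Lemma L2norm_hoelder Om d h : measurable Om -> in_L2 Om d -> in_L2 Om h ->
  mu.-integrable Om (EFin \o (fun x => d x * h x)) /\
  (`|\int[mu]_(x in Om) (d x * h x)|%:E <= L2norm Om d * L2norm Om h)%E.
Proof.
move=> mOm d2 h2.
have dhE : (fun x => d x * h x) \_ Om = (d \_ Om \* h \_ Om)%R.
  by apply/funext => x; rewrite /= !patchE; case: ifP => // _; rewrite mul0r.
have dhi : mu.-integrable Om (EFin \o (fun x => d x * h x)).
  apply/integrable_patch => //; rewrite dhE.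
  by have /Lfun1_integrable := Lfun2_mul_Lfun1 d2 h2.
split => //.
have N1 : (`|\int[mu]_(x in Om) (d x * h x)|%:E <= 'N[mu]_1[EFin \o (d \_ Om \* h \_ Om)%R])%E.
  rewrite Lnorm1 -dhE EFin_normr_Rintegral//.
  apply: (le_trans (le_abse_integral _ _ _)) => //; first exact: measurable_int dhi.
  rewrite [leRHS](_ : _ = \int[mu]_(x in Om) `|(d x * h x)%:E|)%E//.
  rewrite [RHS]integral_mkcond; apply: eq_integral => x _.
  by rewrite /= !patchE; case: ifP => //; rewrite normr0.
apply: (le_trans N1); move: (d2) (h2); rewrite /in_L2 !inE => /andP[+ _] /andP[+ _].
rewrite !inE/= => md mh.
by apply: (@hoelder _ _ _ mu _ _ 2 2) => //; rewrite [RHS]splitr !div1r.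
Qed.

Lemma L2norm_lty Om h : in_L2 Om h -> (L2norm Om h \is a fin_num)%E.
Proof.
rewrite /in_L2 inE => /andP[_]; rewrite inE/= /finite_norm => h2.
by rewrite ge0_fin_numE// Lnorm_ge0.
Qed.

(** By Hoelder's inequality, convergence in norm passes to the pairing with a fixed [h]. This turns
    the vector-valued continuity and differentiability of the solution into statements about scalar
    moments. *)
Lemma L2norm_cvg_inner (F : set_system R) (u : R -> R -> R) v h Om : Filter F ->
  measurable Om -> in_L2 Om h -> in_L2 Om v -> (\forall s \near F, in_L2 Om (u s)) ->
  L2norm Om (u s \- v) @[s --> F] --> 0%E ->
  \int[mu]_(x in Om) (u s x * h x) @[s --> F] --> \int[mu]_(x in Om) (v x * h x).
Proof.
move=> FF mOm h2 v2 u2 uv; apply/cvgrPdist_le => e e0.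
(* The added 1 keeps [C] positive when the norm of [h] is zero. *)
pose C := fine (L2norm Om h) + 1.
have C0 : 0 < C by rewrite ltr_wpDl// fine_ge0// Lnorm_ge0.
have hC : (L2norm Om h <= C%:E)%E.
  by rewrite -(fineK (L2norm_lty h2)) lee_fin lerDl.
have eC : 0 < e / C by rewrite divr_gt0.
move/fine_cvgP: uv => [uvfin /cvgrPdist_le/(_ _ eC) uv].
near=> s.
have us2 : in_L2 Om (u s) by near: s.
have [_ ds] := L2norm_hoelder mOm (in_L2B us2 v2) h2.
have [i1 _] := L2norm_hoelder mOm us2 h2.
have [i2 _] := L2norm_hoelder mOm v2 h2.
rewrite distrC -RintegralB// -lee_fin.
rewrite (_ : \int[mu]_(x in Om) _ = \int[mu]_(x in Om) ((u s \- v) x * h x)); last first.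
  by apply: eq_Rintegral => x _; rewrite /= mulrBl.
apply: (le_trans ds); have sfin : L2norm Om (u s \- v) \is a fin_num by near: s.
apply: (@le_trans _ _ ((e / C)%:E * C%:E)%E); last by rewrite -EFinM divfK// gt_eqF.
apply: lee_pmul => //; rewrite ?Lnorm_ge0//.
rewrite -(fineK sfin) lee_fin.
have : `|0 - fine (L2norm Om (u s \- v))| <= e / C by near: s.
by rewrite sub0r normrN; apply: le_trans; exact: ler_norm.
Unshelve. all: by end_near. Qed.

End square_integrable.

(** * Weak derivatives *)

Section weak_derivative_FTC.
Context {R : realType}.
Notation mu := (@lebesgue_measure R).
Implicit Types (a b c d e k delta : R) (u v : R -> R).

(** The argument is expanded to fit [smooth_affine]; [rampE] gives the readable form
    [step ((x - c) / e)], a rise from 0 to 1 over [[c, c + e]]. *)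
Definition ramp c e (x : R) : R := step (e^-1 * x + - (e^-1 * c)).

Lemma rampE c e x : ramp c e x = step ((x - c) / e).
Proof. by rewrite /ramp mulrC [e^-1 * c]mulrC -mulrBl. Qed.

Lemma smooth_ramp c e : smooth (ramp c e).
Proof. exact/smooth_affine/smooth_step. Qed.

Lemma ramp0 c e x : 0 < e -> x <= c -> ramp c e x = 0.
Proof. by move=> e0 xc; rewrite rampE step0// pmulr_lle0 ?invr_gt0// subr_le0. Qed.

Lemma ramp1 c e x : 0 < e -> c + e <= x -> ramp c e x = 1.
Proof. by move=> e0 cx; rewrite rampE step1// ler_pdivlMr// mul1r lerBrDl. Qed.

Lemma ramp_ge0 c e x : 0 <= ramp c e x. Proof. exact: step_ge0. Qed.

Lemma ramp_le1 c e x : ramp c e x <= 1. Proof. exact: step_le1. Qed.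

Lemma derive1_rampE c e x : derive1 (ramp c e) x = derive1 step ((x - c) / e) * e^-1.
Proof.
rewrite derive1E; apply: derive_val.
have -> : (x - c) / e = e^-1 * x + - (e^-1 * c).
  by rewrite mulrBl mulrC [c / e]mulrC.
apply: is_derive1_comp; first exact/smooth_is_derive/smooth_step.
have := is_deriveD (is_deriveZ e^-1 (is_derive_id x 1)) (is_derive_cst (- (e^-1 * c)) x 1).
by rewrite addr0 /GRing.scale/= mulr1.
Qed.

Lemma derive1_ramp_ge0 c e x : 0 < e -> 0 <= derive1 (ramp c e) x.
Proof.
move=> e0; rewrite derive1_rampE mulr_ge0 ?derive1_step_ge0//.
by rewrite invr_ge0 ltW.
Qed.

Lemma derive1_ramp_outside c e x : 0 < e -> ~~ (c <= x <= c + e) ->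
  derive1 (ramp c e) x = 0.
Proof.
move=> e0 xce; rewrite derive1_rampE derive1_step_outside ?mul0r//.
apply: contra xce; rewrite pmulr_lge0 ?invr_gt0// subr_ge0.
by rewrite ler_pdivrMr// mul1r lerBlDl.
Qed.

(** The derivative of the ramp is a probability density on [[c, c + e]], so the integral is an
    average of values of [u] within [delta] of [k]. *)
Lemma ramp_average a b c e k delta u : a < b -> a <= c -> 0 < e -> c + e <= b ->
  {within `[a, b], continuous u} ->
  (forall x, c <= x <= c + e -> `|u x - k| <= delta) ->
  `|\int[mu]_(x in `]a, b[) (u x * derive1 (ramp c e) x) - k| <= delta.
Proof.
move=> ab ac e0 ceb cu uk.
have ck := @smooth_within_continuous R a b _ (smooth_derive (@smooth_ramp c e)).
have cr := @smooth_within_continuous R a b _ (@smooth_ramp c e).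
have int1 : \int[mu]_(x in `]a, b[) derive1 (ramp c e) x = 1.
  have dr x : a < x < b -> is_derive x 1 (ramp c e) (derive1 (ramp c e) x).
    by move=> _; exact/smooth_is_derive/smooth_ramp.
  by rewrite (FTC2_oo ab cr ck dr) ramp1// ramp0// subr0.
have i1 := within_continuous_integrable ck.
have i2 := within_continuous_integrable (within_continuousM cu ck).
have i3 : mu.-integrable `]a, b[ (EFin \o (fun x => k * derive1 (ramp c e) x)).
  exact: integrableRZ.
have i4 := integrableRB (measurable_itv _) i2 i3.
rewrite -{1}(mulr1 k) -int1 -RintegralZl// -RintegralB//.
apply: le_trans (le_normr_Rintegral _ i4) _ => //.
rewrite -[leRHS]mulr1 -int1 -RintegralZl//; apply: le_Rintegral => //.
- exact: (integrable_norm i4).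
- exact: integrableRZ.
- move=> x _; rewrite -mulrBl normrM (ger0_norm (derive1_ramp_ge0 _ _ e0)).
  have [xce|xce] := boolP (c <= x <= c + e).
    by rewrite ler_wpM2r ?derive1_ramp_ge0// uk.
  by rewrite derive1_ramp_outside// !mulr0.
Qed.

Lemma within_continuous_endpoints a b u : a < b -> {within `[a, b], continuous u} ->
  forall delta, 0 < delta -> exists2 e0, 0 < e0 & forall x, a <= x <= b ->
    (x <= a + e0 -> `|u x - u a| <= delta) /\ (b - e0 <= x -> `|u x - u b| <= delta).
Proof.
move=> ab /(continuous_within_itvP _ ab)[_ ua ub] delta d0.
have /cvgrPdist_le /(_ _ d0) [e1 /= e10 h1] := ua.
have /cvgrPdist_le /(_ _ d0) [e2 /= e20 h2] := ub.
exists (Num.min e1 e2 / 2) => [|x /andP[ax xb]]; first by rewrite divr_gt0// lt_min e10.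
split => [xa|bx].
- have [->|xna] := eqVneq x a; first by rewrite subrr normr0 ltW.
  rewrite distrC; apply: h1; last by rewrite lt_neqAle eq_sym xna.
  rewrite /= ler0_norm ?subr_le0// opprB (@le_lt_trans _ _ (Num.min e1 e2 / 2))//.
    by rewrite lerBlDl.
  rewrite ltr_pdivrMr// (@le_lt_trans _ _ e1) ?ge_min ?lexx//.
  by rewrite ltr_pMr// ltr1n.
- have [->|xnb] := eqVneq x b; first by rewrite subrr normr0 ltW.
  rewrite distrC; apply: h2; last by rewrite lt_neqAle xnb.
  rewrite /= ger0_norm ?subr_ge0// (@le_lt_trans _ _ (Num.min e1 e2 / 2))//.
    by rewrite lerBlDl -lerBlDr.
  rewrite ltr_pdivrMr// (@le_lt_trans _ _ e2) ?ge_min ?lexx ?orbT//.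
  by rewrite ltr_pMr// ltr1n.
Qed.

(** Test with trapezoids that increase to 1 on the whole interval. On the side of [v] they tend to
    the plain integral; on the side of [u] their two slopes average [u] near each endpoint. *)
Lemma weak_derivative_FTC a b u v : a < b -> {within `[a, b], continuous u} ->
  mu.-integrable `]a, b[ (EFin \o v) -> weak_derivative `]a, b[ u v ->
  \int[mu]_(x in `]a, b[) v x = u b - u a.
Proof.
move=> ab cu iv wuv.
(* Each trapezoid rises on [[a + e n, a + 2 e n]] and falls on [[b - 2 e n, b - e n]]. Strips of
   width [e n] keep the support inside []a, b[], and [4 * e n <= b - a] makes the rise end before
   the fall begins. *)
pose e (n : nat) := (b - a) / n.+4%:R.
have e0 n : 0 < e n by rewrite divr_gt0// subr_gt0.
have e4 n : 4 * e n <= b - a.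
  by rewrite /e mulrCA ger_pMr ?subr_gt0// ler_pdivrMr// mul1r ler_nat.
have ecvg : e n @[n --> \oo] --> (0 : R).
  rewrite -(mulr0 (b - a)); apply: cvgMr.
  have := @cvg_harmonic R; rewrite -(cvg_shiftn 3).
  by under [in X in X -> _]eq_fun do rewrite addn3.
pose phi n x := ramp (a + e n) (e n) x - ramp (b - 2 * e n) (e n) x.
have sphi n : smooth (phi n).
  have -> : phi n = ramp (a + e n) (e n) \+ (cst (-1) \* ramp (b - 2 * e n) (e n)).
    by apply/funext => x; rewrite /phi/= mulN1r.
  apply: smoothD; first exact: smooth_ramp.
  by apply: smoothM; [exact: smooth_cst|exact: smooth_ramp].
have dphi n x : derive1 (phi n) x =
    derive1 (ramp (a + e n) (e n)) x - derive1 (ramp (b - 2 * e n) (e n)) x.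
  rewrite derive1E; apply: derive_val.
  by apply: is_deriveB; exact/smooth_is_derive/smooth_ramp.
have tphi n : test_function `]a, b[ (phi n).
  apply: (@test_function_itv _ _ _ (a + e n) (b - e n)) => //.
  - by rewrite ltrDl.
  - by rewrite ltrBlDr ltrDl.
  - have := e4 n; have := e0 n => ? ? x; rewrite negb_and -!ltNge => /orP[xa|xb].
      by rewrite /phi !ramp0 ?subrr//; lra.
    by rewrite /phi !ramp1 ?subrr//; lra.
have cvgv : \int[mu]_(x in `]a, b[) (v x * phi n x) @[n --> \oo] -->
    \int[mu]_(x in `]a, b[) v x.
  apply: (@Rintegral_dominated_cvg _ `]a, b[ _ _ (fun x => `|v x|)) => //.
  - move=> n; apply/measurable_EFinP.
    have := integrable_mul_continuous iv (@smooth_within_continuous _ a b _ (sphi n)).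
    exact: measurable_int.
  - by apply/measurable_EFinP; exact: measurable_int iv.
  - apply: aeW => x; rewrite /= in_itv/= => /andP[ax xb].
    apply: cvg_near_cst.
    (* As soon as [2 * e n] is below the distance from [x] to both endpoints, [phi n x] equals 1. *)
    have m0 : 0 < Num.min (x - a) (b - x) / 2 by rewrite divr_gt0// lt_min !subr_gt0 ax.
    move: ecvg => /cvgrPdist_lt /(_ _ m0); apply: filterS => n.
    rewrite sub0r normrN gtr0_norm// ltr_pdivlMr// lt_min => /andP[h1 h2].
    rewrite /phi ramp1// ?ramp0// ?subr0 ?mulr1//; lra.
  - exact: (integrable_norm iv).
  - move=> n x _; rewrite normrM ler_piMr// ler_norml.
    have := ramp_ge0 (a + e n) (e n) x; have := ramp_le1 (a + e n) (e n) x.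
    have := ramp_ge0 (b - 2 * e n) (e n) x; have := ramp_le1 (b - 2 * e n) (e n) x.
    by rewrite /phi => *; apply/andP; split; lra.
have cvgu : \int[mu]_(x in `]a, b[) (u x * derive1 (phi n) x) @[n --> \oo] --> u a - u b.
  apply/cvgrPdist_le => delta d0.
  have d20 : 0 < delta / 2 by rewrite divr_gt0.
  have [e1 e10 he1] := within_continuous_endpoints ab cu d20.
  (* Both slopes lie within [2 * e n] of an endpoint, hence the half. *)
  have m0 : 0 < e1 / 2 by rewrite divr_gt0.
  move: ecvg => /cvgrPdist_lt /(_ _ m0); apply: filterS => n.
  rewrite sub0r normrN gtr0_norm// => en.
  have := e4 n; have := e0 n => en0 en4.
  rewrite (_ : \int[mu]_(x in _) _ =
      \int[mu]_(x in `]a, b[) (u x * derive1 (ramp (a + e n) (e n)) x) -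
      \int[mu]_(x in `]a, b[) (u x * derive1 (ramp (b - 2 * e n) (e n)) x)); last first.
    rewrite -RintegralB//; first by apply: eq_Rintegral => x _; rewrite dphi mulrBr.
    - apply/within_continuous_integrable/within_continuousM => //.
      exact/smooth_within_continuous/smooth_derive/smooth_ramp.
    - apply/within_continuous_integrable/within_continuousM => //.
      exact/smooth_within_continuous/smooth_derive/smooth_ramp.
  have h1 := @ramp_average a b (a + e n) (e n) (u a) (delta / 2) u ab.
  have h2 := @ramp_average a b (b - 2 * e n) (e n) (u b) (delta / 2) u ab.
  have {}h1 : `|\int[mu]_(x in `]a, b[) (u x * derive1 (ramp (a + e n) (e n)) x) - u a| <= delta / 2.
    apply: h1 => //; [lra|lra|move=> x /andP[? ?]].
    by have [] := he1 x; [apply/andP; split; lra|move=> + _; apply; lra].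
  have {}h2 : `|\int[mu]_(x in `]a, b[) (u x * derive1 (ramp (b - 2 * e n) (e n)) x) - u b| <= delta / 2.
    apply: h2 => //; [lra|lra|move=> x /andP[? ?]].
    by have [] := he1 x; [apply/andP; split; lra|move=> _; apply; lra].
  rewrite opprB [X in _ + X]addrC addrACA (splitr delta) (le_trans (ler_normD _ _))// lerD//.
    by rewrite distrC.
  by rewrite addrC.
have : u a - u b = - \int[mu]_(x in `]a, b[) v x.
  apply: (cvg_unique _ cvgu) => //.
  rewrite (_ : (fun n => _) = (fun n => - \int[mu]_(x in `]a, b[) (v x * phi n x))).
    exact: cvgN.
  by apply/funext => n; exact/wuv/tphi.
by move=> h; apply: oppr_inj; rewrite -h opprB.
Qed.

End weak_derivative_FTC.

(** * Rules of calculus for weak derivatives *)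

Section weak_derivative_calculus.
Context {R : realType}.
Notation mu := (@lebesgue_measure R).
Implicit Types (a b c d k : R) (f u v : R -> R).

(** Integrability is bundled in because splitting the defining integrals requires it, as does
    [weak_derivative_FTC] for [v]. *)
Definition has_weak_derivative a b u v :=
  [/\ mu.-integrable `]a, b[ (EFin \o u), mu.-integrable `]a, b[ (EFin \o v) &
      weak_derivative `]a, b[ u v].

(** Used to pass from the half-line of the weak formulation to bounded time intervals, on which the
    functions are integrable. *)
Lemma Rintegral_vanish_outside (Om Om' : set R) (w h : R -> R) : Om' `<=` Om ->
  (forall x, ~ Om' x -> h x = 0) ->
  \int[mu]_(x in Om) (w x * h x) = \int[mu]_(x in Om') (w x * h x).
Proof.
move=> sub h0; rewrite Rintegral_mkcond [RHS]Rintegral_mkcond; congr Rintegral.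
apply/funext => x; rewrite !patchE; case: ifPn => xOm; case: ifPn => xOm' //.
- by rewrite h0 ?mulr0// => /mem_set; exact/negP.
- by move/negP: xOm; case; apply/mem_set/sub/set_mem.
Qed.

Lemma weak_derivative_subset (Om Om' : set R) u v : Om' `<=` Om ->
  weak_derivative Om u v -> weak_derivative Om' u v.
Proof.
move=> sub uv phi tphi; have := uv _ (test_function_sub sub tphi).
by rewrite !(Rintegral_vanish_outside _ sub)// => x /(test_function_outside tphi)[].
Qed.

Lemma has_weak_derivative_subset a b c d u v : a <= c -> d <= b ->
  has_weak_derivative a b u v -> has_weak_derivative c d u v.
Proof.
move=> ac db [ui vi uv].
have sub : `]c, d[ `<=` `]a, b[ by apply: subset_itvW.
split; [exact: integrableS ui|exact: integrableS vi|exact: weak_derivative_subset uv].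
Qed.

Lemma eq_has_weak_derivative a b u v u' v' :
  (forall x, a < x < b -> u x = u' x) -> (forall x, a < x < b -> v x = v' x) ->
  has_weak_derivative a b u v -> has_weak_derivative a b u' v'.
Proof.
move=> uu vv [ui vi uv].
have uu' : {in (`]a, b[%classic : set R), u =1 u'}.
  by move=> x; rewrite inE/= in_itv/=; exact: uu.
have vv' : {in (`]a, b[%classic : set R), v =1 v'}.
  by move=> x; rewrite inE/= in_itv/=; exact: vv.
split; [exact: eq_integrableR uu' ui|exact: eq_integrableR vv' vi|].
move=> phi /uv; rewrite (_ : \int[mu]_(x in `]a, b[) (u x * _) =
    \int[mu]_(x in `]a, b[) (u' x * derive1 phi x)); last first.
  by apply: eq_Rintegral => x xab; rewrite uu'.
by move=> ->; congr -%R; apply: eq_Rintegral => x xab; rewrite vv'.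
Qed.

Lemma integrable_mul_smooth a b u f : mu.-integrable `]a, b[ (EFin \o u) -> smooth f ->
  mu.-integrable `]a, b[ (EFin \o (fun x => u x * f x)).
Proof. by move=> ui sf; apply: integrable_mul_continuous => //; exact: smooth_within_continuous. Qed.

Lemma has_weak_derivativeD a b u1 v1 u2 v2 : has_weak_derivative a b u1 v1 ->
  has_weak_derivative a b u2 v2 ->
  has_weak_derivative a b (fun x => u1 x + u2 x) (fun x => v1 x + v2 x).
Proof.
move=> [u1i v1i uv1] [u2i v2i uv2].
split; [exact: integrableRD|exact: integrableRD|move=> phi tphi].
have sphi := test_function_smooth tphi.
have sphi' := smooth_derive sphi.
under eq_Rintegral do rewrite mulrDl.
rewrite RintegralD//; try exact: integrable_mul_smooth.
rewrite uv1// uv2// -opprD -RintegralD//; try exact: integrable_mul_smooth.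
by congr -%R; apply: eq_Rintegral => x _; rewrite mulrDl.
Qed.

Lemma has_weak_derivativeM a b u v f : has_weak_derivative a b u v -> smooth f ->
  has_weak_derivative a b (fun x => f x * u x) (fun x => f x * v x + derive1 f x * u x).
Proof.
move=> [ui vi uv] sf; have sf' := smooth_derive sf.
have com (w h : R -> R) : mu.-integrable `]a, b[ (EFin \o w) -> smooth h ->
    mu.-integrable `]a, b[ (EFin \o (fun x => h x * w x)).
  move=> wi sh; apply: eq_integrableR (integrable_mul_smooth wi sh) => // x _.
  exact: mulrC.
split; [exact: com|by apply: integrableRD => //; exact: com|move=> phi tphi].
have sphi := test_function_smooth tphi; have sphi' := smooth_derive sphi.
(* The product rule is the weak identity for [u] tested with [f * phi], whose derivative supplies
   the extra term. *)
have := uv _ (test_functionM tphi sf).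
have d x : derive1 (fun x => f x * phi x) x = f x * derive1 phi x + phi x * derive1 f x.
  rewrite derive1E; apply: derive_val.
  by apply: is_deriveM; exact: smooth_is_derive.
have i1 := com _ _ (integrable_mul_smooth ui sphi') sf.
have i2 := com _ _ (integrable_mul_smooth ui sphi) sf'.
have i3 := com _ _ (integrable_mul_smooth vi sphi) sf.
rewrite (_ : \int[mu]_(x in _) (u x * _) =
  \int[mu]_(x in `]a, b[) (f x * (u x * derive1 phi x)) +
  \int[mu]_(x in `]a, b[) (derive1 f x * (u x * phi x))); last first.
  by rewrite -RintegralD//; apply: eq_Rintegral => x _; rewrite d; ring.
rewrite (_ : \int[mu]_(x in _) (v x * _) =
  \int[mu]_(x in `]a, b[) (f x * (v x * phi x))); last first.
  by apply: eq_Rintegral => x _; ring.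
move=> /eqP; rewrite -subr_eq0 opprK addrAC => /eqP h.
apply/eqP; rewrite -subr_eq0 opprK -[X in _ == X]h -addrA; apply/eqP; congr (_ + _).
  by apply: eq_Rintegral => x _; rewrite mulrA.
rewrite addrC -RintegralD//.
by apply: eq_Rintegral => x _; ring.
Qed.

Lemma has_weak_derivativeZ a b u v k : has_weak_derivative a b u v ->
  has_weak_derivative a b (fun x => k * u x) (fun x => k * v x).
Proof.
move=> /has_weak_derivativeM/(_ (@smooth_cst _ k)).
by apply: eq_has_weak_derivative => // x _; rewrite derive1_cst mul0r addr0.
Qed.

Lemma has_weak_derivative_sum a b n (u v : 'I_n -> R -> R) :
  (forall i, has_weak_derivative a b (u i) (v i)) ->
  has_weak_derivative a b (fun x => \sum_(i < n) u i x) (fun x => \sum_(i < n) v i x).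
Proof.
elim: n u v => [|n IH] u v uv.
  have h0 : has_weak_derivative a b (cst 0) (cst 0).
    split; try by apply: within_continuous_integrable => x; exact: cvg_cst.
    move=> phi _; under eq_Rintegral do rewrite mul0r.
    under [in RHS]eq_Rintegral do rewrite mul0r.
    by rewrite Rintegral_cst// mul0r oppr0.
  by apply: eq_has_weak_derivative h0 => x _; rewrite big_ord0.
have := has_weak_derivativeD (IH _ _ (fun i => uv (widen_ord (leqnSn n) i))) (uv ord_max).
by apply: eq_has_weak_derivative => x _; rewrite big_ord_recr.
Qed.

Lemma derivable_has_weak_derivative a b f df : a < b ->
  {within `[a, b], continuous f} -> {within `[a, b], continuous df} ->
  (forall x, a < x < b -> is_derive x 1 f (df x)) -> has_weak_derivative a b f df.
Proof.
move=> ab cf cdf fdf; split; try exact: within_continuous_integrable.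
by move=> phi tphi; apply: test_function_by_parts.
Qed.

Lemma has_weak_derivative_FTC a b u v : a < b -> {within `[a, b], continuous u} ->
  has_weak_derivative a b u v -> \int[mu]_(x in `]a, b[) v x = u b - u a.
Proof. by move=> ab cu [_ vi uv]; exact: weak_derivative_FTC. Qed.

End weak_derivative_calculus.

(** * Powers and affine substitutions *)

Section powers.
Context {R : realType}.
Notation mu := (@lebesgue_measure R).

Lemma exp_within_continuous (a b : R) n : {within `[a, b], continuous (fun x : R => x ^+ n)}.
Proof. exact/smooth_within_continuous/smooth_exp. Qed.

Lemma exp_in_L2 (a b : R) n : in_L2 `]a, b[ (fun x : R => x ^+ n).
Proof. exact/continuous_in_L2/exp_within_continuous. Qed.

Lemma derive1_exp n (x : R) : derive1 (fun x : R => x ^+ n) x = n%:R * x ^+ n.-1.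
Proof.
rewrite derive1E (_ : (fun x => _) = id ^+ n); last by apply/funext => ?; rewrite exprfctE.
by rewrite deriveX// derive_id /GRing.scale/= mulr1.
Qed.

Lemma smooth_patch_mul (a b : R) (w f : R -> R) : mu.-integrable `]a, b[ (EFin \o w) -> smooth f ->
  mu.-integrable setT (EFin \o (fun x => f x * (w \_ `]a, b[) x)) /\
  \int[mu]_x (f x * (w \_ `]a, b[) x) = \int[mu]_(x in `]a, b[) (f x * w x).
Proof.
move=> wi sf.
have fw : (fun x => f x * (w \_ `]a, b[) x) = (fun x => f x * w x) \_ `]a, b[.
  by apply/funext => x; rewrite !patchE; case: ifP => // _; rewrite mulr0.
split; last by rewrite [RHS]Rintegral_mkcond; congr Rintegral.
rewrite fw; apply: (integrable_patch (fun x => f x * w x) (measurable_itv `]a, b[)).1.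
by apply: eq_integrableR (integrable_mul_smooth wi sf) => // x _; rewrite mulrC.
Qed.

(* The substitution [s = e x + c] with [e = 1] or [e = -1]. *)
Lemma exp_patch_shift (a b c e : R) (w : R -> R) n : e ^+ 2 = 1 ->
  mu.-integrable `]a, b[ (EFin \o w) ->
  mu.-integrable setT (EFin \o (fun s => s ^+ n * (w \_ `]a, b[) (e * (s - c)))) /\
  \int[mu]_s (s ^+ n * (w \_ `]a, b[) (e * (s - c))) =
  \int[mu]_(x in `]a, b[) ((e * x + c) ^+ n * w x).
Proof.
move=> e2 wi; have [i1 I1] := smooth_patch_mul wi (@smooth_affine_exp R e c n).
have ph : preserves_lebesgue (fun s : R => e * (s - c)).
  have : (e == 1) || (e == -1) by rewrite -eqf_sqr expr1n e2.
  case/orP => /eqP ->.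
    have := preserves_lebesgue_shift (- c); congr preserves_lebesgue.
    by apply/funext => s; rewrite mul1r.
  have := preserves_lebesgue_reflect c; congr preserves_lebesgue.
  by apply/funext => s; rewrite mulN1r opprB.
have E : (fun s => s ^+ n * (w \_ `]a, b[) (e * (s - c))) =
    (fun x => (e * x + c) ^+ n * (w \_ `]a, b[) x) \o (fun s => e * (s - c)).
  by apply/funext => s /=; rewrite mulrA -expr2 e2 mul1r subrK.
split; first by rewrite E; exact: preserves_lebesgue_integrable.
by rewrite -I1 -(preserves_lebesgue_Rintegral ph i1); congr Rintegral.
Qed.

End powers.

(** * Determination by moments *)

Section moments.
Context {R : realType}.
Notation mu := (@lebesgue_measure R).
Implicit Types (a b c t x : R) (w : R -> R).

Lemma bernoulli_ge (s : R) n : -1 <= s -> 1 + n%:R * s <= (1 + s) ^+ n.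
Proof.
move=> s1; elim: n => [|n IH]; first by rewrite mul0r addr0 expr0.
have s0 : 0 <= 1 + s by lra.
rewrite exprS (le_trans _ (ler_wpM2l s0 IH))//.
have n0 : 0 <= n%:R * (s * s) by rewrite mulr_ge0// -expr2 sqr_ge0.
by rewrite -natr1; nra.
Qed.

(** Polynomials from the elementary proof of the Stone-Weierstrass theorem: on [[0, 1]] they stay
    between 0 and 1 and converge to the indicator of [t < 1/2], except at [1/2]. Below [1/2],
    Bernoulli's inequality bounds them from below by [1 - (2 * t) ^+ k]. *)
Definition threshold k t : R := (1 - t ^+ k) ^+ (2 ^ k).

Lemma threshold_itv k t : 0 <= t <= 1 -> 0 <= threshold k t <= 1.
Proof.
move=> t01; have /andP[tk0 tk1] : 0 <= t ^+ k <= 1.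
  by move/andP: t01 => [? ?]; rewrite exprn_ge0// exprn_ile1.
by rewrite exprn_ge0 ?exprn_ile1 ?subr_ge0// gerBl.
Qed.

Lemma threshold_cvg1 t : 0 <= t -> t < 2^-1 -> threshold k t @[k --> \oo] --> (1 : R).
Proof.
move=> t0 t1; apply: (@squeeze_cvgr _ _ _ _ (fun k => 1 - (2 * t) ^+ k) (cst 1)).
- apply: nearW => k; apply/andP; split; last first.
    suff /(threshold_itv k)/andP[] : 0 <= t <= 1 by [].
    by rewrite t0/= (le_trans (ltW t1))// invf_le1// ler1n.
  have := @bernoulli_ge (- t ^+ k) (2 ^ k).
  rewrite natrX mulrN -exprMn; apply; rewrite lerN2 exprn_ile1//; lra.
- rewrite -[X in _ --> X]subr0; apply: cvgB; first exact: cvg_cst.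
  apply: cvg_expr; rewrite ger0_norm; lra.
- exact: cvg_cst.
Qed.

Lemma threshold_cvg0 t : 2^-1 < t -> t <= 1 -> threshold k t @[k --> \oo] --> (0 : R).
Proof.
move=> t0 t1; have tt : 0 <= t <= 1 by apply/andP; split; lra.
apply: (@squeeze_cvgr _ _ _ _ (cst 0) (fun k => (2 * t)^-1 ^+ k)).
- apply: nearW => k; apply/andP; split; first by have /andP[] := threshold_itv k tt.
  have [tk0 tk1] : 0 <= t ^+ k /\ t ^+ k <= 1.
    by move/andP: tt => [? ?]; rewrite exprn_ge0// exprn_ile1.
  rewrite exprVn -div1r ler_pdivlMr; last by rewrite exprn_gt0//; lra.
  (* The factor [(1 + t ^+ k) ^+ (2 ^ k)] is at least [(2 * t) ^+ k] by Bernoulli, and its product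
     with the threshold is a power of [1 - t ^+ (2 * k)], hence at most 1. *)
  apply: (@le_trans _ _ (threshold k t * (1 + t ^+ k) ^+ (2 ^ k))).
    have /andP[th0 _] := threshold_itv k tt.
    rewrite ler_wpM2l// (le_trans _ (bernoulli_ge _ _)) ?(le_trans _ tk0) ?lerN10//.
    by rewrite natrX -exprMn lerDr.
  rewrite /threshold -exprMn -subr_sqr expr1n; apply: exprn_ile1.
    by rewrite subr_ge0 exprn_ile1.
  by rewrite gerBl sqr_ge0.
- exact: cvg_cst.
- apply: cvg_expr; rewrite ger0_norm ?invr_ge0; last lra.
  rewrite invf_lt1; lra.
Qed.

Lemma moments_horner a b w : mu.-integrable `]a, b[ (EFin \o w) ->
  (forall n, \int[mu]_(x in `]a, b[) (x ^+ n * w x) = 0) ->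
  forall p : {poly R}, \int[mu]_(x in `]a, b[) (p.[x] * w x) = 0.
Proof.
move=> wi w0 p.
(* The extra factor [x ^+ n] lets the induction absorb the multiplication by ['X]. *)
suff : forall n, \int[mu]_(x in `]a, b[) (x ^+ n * p.[x] * w x) = 0.
  by move=> /(_ 0%N) <-; apply: eq_Rintegral => x _; rewrite mul1r.
have int (f : R -> R) : continuous f -> mu.-integrable `]a, b[ (EFin \o (fun x => f x * w x)).
  move=> cf; have := @integrable_mul_continuous _ a b _ _ wi (continuous_subspaceT cf).
  by apply: eq_integrableR => // x _; rewrite mulrC.
elim/poly_ind: p => [|p c IH] n.
  by under eq_Rintegral do rewrite horner0 mulr0 mul0r; rewrite Rintegral_cst// mul0r.
have cX k : continuous (fun x : R => x ^+ k) by move=> x; exact: exprn_continuous.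
transitivity (\int[mu]_(x in `]a, b[) (x ^+ n.+1 * p.[x] * w x) +
              \int[mu]_(x in `]a, b[) (c * (x ^+ n * w x))); last first.
  by rewrite IH add0r RintegralZl// ?w0 ?mulr0//; exact: int.
rewrite -RintegralD//.
- by apply: eq_Rintegral => x _; rewrite hornerMXaddC exprSr; ring.
- apply: (@int (fun x => x ^+ n.+1 * p.[x])) => x.
  exact: (cvgM (cX n.+1 x) (@continuous_horner _ p x)).
- by apply: integrableRZ => //; exact: int.
Qed.

(** The indicator of a half-line is a bounded pointwise limit of polynomials almost everywhere, so
    dominated convergence carries the vanishing moments over to it. *)
Lemma moments_initial_itv a b w : mu.-integrable `]a, b[ (EFin \o w) ->
  (forall n, \int[mu]_(x in `]a, b[) (x ^+ n * w x) = 0) ->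
  forall c, a < c < b -> \int[mu]_(x in `]a, b[) (\1_`]-oo, c] x * w x) = 0.
Proof.
move=> wi w0 c /andP[ac cb].
have mw : measurable_fun (`]a, b[ : set (measurableTypeR R)) w.
  by apply/measurable_EFinP; exact: measurable_int wi.
(* Affine, maps []a, b[] into [[0, 1]] and [c] to [1/2], the jump of the limit of [threshold]. *)
pose q x := 2^-1 + (x - c) / (2 * (b - a)).
have ba : 0 < 2 * (b - a) by lra.
have q01 x : a < x < b -> 0 <= q x <= 1.
  move=> /andP[ax xb]; rewrite /q.
  have := ler_pdivrMr (2^-1) (x - c) ba; have := ler_pdivlMr (- 2^-1) (x - c) ba.
  by move=> h1 h2; apply/andP; split; [rewrite -lerBlDl sub0r h1|rewrite -lerBrDl]; lra.
pose p k : {poly R} :=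
  (1 - (((2 * (b - a))^-1)%:P * 'X + (2^-1 - c / (2 * (b - a)))%:P) ^+ k) ^+ (2 ^ k).
have pE k x : (p k).[x] = threshold k (q x).
  rewrite /p /threshold !(hornerE, horner_exp); congr ((1 - _ ^+ _) ^+ _).
  by rewrite /q/= mulrBl [x / _]mulrC addrA; congr (_ - _); exact: addrC.
have cv : \int[mu]_(x in `]a, b[) (threshold k (q x) * w x) @[k --> \oo] -->
    \int[mu]_(x in `]a, b[) (\1_`]-oo, c] x * w x).
  apply: (@Rintegral_dominated_cvg _ `]a, b[ _ _ (fun x => `|w x|)) => //.
  - move=> k; apply: measurable_funM => //.
    apply: (@measurable_funS _ _ _ _ setT) => //.
    apply: continuous_measurable_fun => x.
    rewrite (_ : (fun x => _) = (fun x => (p k).[x])); last by apply/funext => ?; rewrite pE.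
    exact: continuous_horner.
  - exact: measurable_funM.
  - exists [set c]; split; [exact: measurable_set1|exact: lebesgue_measure_set1|].
    move=> x /=; apply: contra_notP => xc; rewrite in_itv/= => xab.
    apply: cvgMl; rewrite indicE mem_setE in_itv/=.
    have /andP[q0 q1] := q01 _ xab; have [xc'|xc'|//] := ltgtP x c.
      apply: threshold_cvg1 => //.
      by rewrite gtrDl pmulr_llt0 ?invr_gt0// subr_lt0.
    by apply: threshold_cvg0 => //; rewrite ltrDl divr_gt0// subr_gt0.
  - exact: integrable_norm.
  - move=> k x; rewrite /= in_itv/= => xab; rewrite normrM ler_piMl//.
    have /andP[? ?] := threshold_itv k (q01 _ xab).
    by rewrite ger0_norm.
apply/esym; apply: (cvg_unique _ _ cv) => //.
rewrite (_ : (fun n => _) = cst 0); first exact: cvg_cst.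
apply/funext => k; rewrite -[RHS](moments_horner wi w0 (p k)).
by apply: eq_Rintegral => x _; rewrite pE.
Qed.

(** All integrals of [w] over initial segments vanish, and Lebesgue differentiation of this zero
    primitive recovers [w]. *)
Lemma moments_ae0 a b w : mu.-integrable `]a, b[ (EFin \o w) ->
  (forall n, \int[mu]_(x in `]a, b[) (x ^+ n * w x) = 0) ->
  {ae mu, forall x, a < x < b -> w x = 0}.
Proof.
move=> wi w0; pose W := w \_ `]a, b[.
have Wi : mu.-integrable setT (EFin \o W).
  exact: ((integrable_patch w (measurable_itv `]a, b[)).1 wi).
have F0 y : \int[mu]_(x in `]-oo, y]) W x = 0.
  rewrite Rintegral_mkcond.
  transitivity (\int[mu]_(x in `]a, b[) (\1_`]-oo, y] x * w x)).
    rewrite [RHS]Rintegral_mkcond; apply: eq_Rintegral => x _.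
    rewrite /W !patchE/= indicE !mem_setE/= !in_itv/=.
    by case: (x <= y); case: (a < x < b); rewrite ?mul1r ?mul0r.
  have [ya|ay] := leP y a.
    rewrite -[RHS](mul0r (fine (mu `]a, b[))) -Rintegral_cst//.
    apply: eq_Rintegral => x; rewrite inE/= in_itv/= => /andP[ax _].
    by rewrite indicE mem_setE in_itv/= leNgt (le_lt_trans ya ax) mul0r.
  have [yb|yb] := ltP y b; first by apply: moments_initial_itv => //; rewrite ay.
  rewrite -(w0 0%N); apply: eq_Rintegral => x; rewrite inE/= in_itv/= => /andP[_ xb].
  by rewrite indicE mem_setE in_itv/= (le_trans (ltW xb) yb).
have Wy (y : R) : mu.-integrable `]-oo, y] (EFin \o W).
  exact: (@integrableS _ _ _ mu setT).
have := FTC1Ny Wy (open_integrable_locally openT Wi).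
apply: filterS; first exact: (ae_filter_ringOfSetsType mu).
move=> x [_]; rewrite (_ : (fun x => _) = cst 0); last exact/funext/F0.
by rewrite derive1_cst /W patchE mem_setE in_itv/= => + xab; rewrite xab.
Qed.

End moments.

(** * Moments of the solution *)

Section moment_equations.
Context {R : realType} (l nu : R) (y0 y1 : R -> R) (y y_x y_t : R -> R -> R) (z : R -> R).
Notation mu := (@lebesgue_measure R).
Hypothesis l0 : 0 < l.
Hypothesis sol : weak_solution l nu y0 y1 y y_x y_t z.
Implicit Types (t s T : R) (n j : nat).

Definition moment (u : R -> R) j : R := \int[mu]_(x in `]0, l[) (u x * x ^+ j).

Lemma moment_cvg (u : R -> R -> R) j : (forall t, 0 <= t -> in_L2 `]0, l[ (u t)) ->
  (forall t, 0 <= t ->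
    L2norm `]0, l[ (u s \- u t) @[s --> within `[0, +oo[ (nbhs t)] --> 0%E) ->
  forall T, 0 < T -> {within `[0, T], continuous (fun t => moment (u t) j)}.
Proof.
move=> u2 uc T T0; apply/subspace_continuousP => t /=; rewrite in_itv/= => /andP[t0 tT].
have cv : moment (u s) j @[s --> within `[0, +oo[ (nbhs t)] --> moment (u t) j.
  apply: L2norm_cvg_inner => //; [exact: exp_in_L2|exact: u2| |exact: uc].
  have := withinT `[0, +oo[%classic (nbhs_filter t); apply: filterS => s /=.
  by rewrite in_itv/= andbT; exact: u2.
apply: cvg_trans cv; apply: cvg_app; apply: within_subset.
by move=> s /=; rewrite !in_itv/= andbT => /andP[].
Qed.

Lemma y_in_Vhalf t : 0 <= t -> in_Vhalf l (y t) (y_x t).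
Proof. exact: (sol_Vhalf sol). Qed.

Lemma y_in_L2 t : 0 <= t -> in_L2 `]0, l[ (y t).
Proof. by move=> /y_in_Vhalf[[]]. Qed.

Lemma y_x_in_L2 t : 0 <= t -> in_L2 `]0, l[ (y_x t).
Proof. by move=> /y_in_Vhalf[[]]. Qed.

Lemma y_t_in_L2 t : 0 <= t -> in_L2 `]0, l[ (y_t t).
Proof. exact: (sol_L2 sol). Qed.

Lemma moment_y_continuous j T : 0 < T -> {within `[0, T], continuous (fun t => moment (y t) j)}.
Proof.
by apply: moment_cvg; [exact: y_in_L2|move=> t t0; have [] := sol_cont sol t0].
Qed.

Lemma moment_y_x_continuous j T : 0 < T ->
  {within `[0, T], continuous (fun t => moment (y_x t) j)}.
Proof.
by apply: moment_cvg; [exact: y_x_in_L2|move=> t t0; have [] := sol_cont sol t0].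
Qed.

Lemma moment_y_t_continuous j T : 0 < T ->
  {within `[0, T], continuous (fun t => moment (y_t t) j)}.
Proof.
by apply: moment_cvg; [exact: y_t_in_L2|move=> t t0; exact: (sol_deriv_cont sol t0)].
Qed.

Lemma moment_y_is_derive j t : 0 < t ->
  is_derive t 1 (fun t => moment (y t) j) (moment (y_t t) j).
Proof.
move=> t0; have t0' := ltW t0.
have cv : \int[mu]_(x in `]0, l[) ((s - t)^-1 * (y s x - y t x) * x ^+ j)
    @[s --> within `[0, +oo[ t^'] --> moment (y_t t) j.
  apply: (@L2norm_cvg_inner _ _ (fun s x => (s - t)^-1 * (y s x - y t x))) => //.
  - exact: exp_in_L2.
  - exact: y_t_in_L2.
  - have := withinT `[0, +oo[%classic (dnbhs_filter t); apply: filterS => s /=.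
    rewrite in_itv/= andbT => s0.
    apply: in_L2Z; apply: in_L2B; exact: y_in_L2.
  - exact: (sol_derivable sol t0').
have quot s : 0 <= s -> \int[mu]_(x in `]0, l[) ((s - t)^-1 * (y s x - y t x) * x ^+ j) =
    (s - t)^-1 * (moment (y s) j - moment (y t) j).
  move=> s0; have [is_ _] := L2norm_hoelder (measurable_itv _) (y_in_L2 s0) (exp_in_L2 0 l j).
  have [it _] := L2norm_hoelder (measurable_itv _) (y_in_L2 t0') (exp_in_L2 0 l j).
  rewrite /moment -RintegralB// -RintegralZl//; last exact: integrableRB.
  by apply: eq_Rintegral => x _; rewrite -mulrBl mulrA.
have key : (fun h : R => h^-1 *: (((fun t => moment (y t) j) \o shift t) (h *: 1) - moment (y t) j))
    @ 0^' --> moment (y_t t) j.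
  apply/cvgrPdist_le => e e0; move/cvgrPdist_le: cv => /(_ _ e0).
  rewrite /within/= => -[d /= d0 hd].
  (* The bound by [t] keeps [h + t] nonnegative, so that the limit along [[0, +oo[] gives a
     two-sided derivative. *)
  exists (Num.min d t) => /=; first by rewrite lt_min d0.
  move=> h; rewrite /ball/= sub0r normrN lt_min => /andP[hd1 ht] h0.
  have s0 : 0 <= h + t.
    by move: ht; rewrite ltr_norml => /andP[ht _]; rewrite -lerBlDr sub0r ltW.
  have := hd (h + t); rewrite quot// addrK /GRing.scale/= mulr1; apply.
  - by rewrite /ball/= opprD addrCA subrr addr0 normrN.
  - by rewrite -subr_eq0 addrK.
  - by rewrite in_itv/= s0.
apply: DeriveDef; first by apply/cvg_ex; exists (moment (y_t t) j).
exact/cvg_lim.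
Qed.

Lemma has_weak_derivative_moment_y j T : 0 < T ->
  has_weak_derivative 0 T (fun t => moment (y t) j) (fun t => moment (y_t t) j).
Proof.
move=> T0; apply: derivable_has_weak_derivative => //.
- exact: moment_y_continuous.
- exact: moment_y_t_continuous.
- by move=> t /andP[t0 _]; exact: moment_y_is_derive.
Qed.

Lemma in_Vhalf_has_weak_derivative f fx : in_Vhalf l f fx -> has_weak_derivative 0 l f fx.
Proof. by move=> [[f2 fx2 ffx] _ _]; split=> //; exact: in_L2_integrable. Qed.

Lemma in_Vhalf_moment0 f fx : in_Vhalf l f fx -> moment fx 0 = f l.
Proof.
move=> ffx; have [_ cf f0] := ffx.
have := has_weak_derivative_FTC l0 cf (in_Vhalf_has_weak_derivative ffx).
rewrite f0 subr0 => <-.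
by apply: eq_Rintegral => x _; rewrite mulr1.
Qed.

Lemma in_Vhalf_momentS f fx j : in_Vhalf l f fx ->
  moment fx j.+1 = l ^+ j.+1 * f l - j.+1%:R * moment f j.
Proof.
move=> ffx; have [_ cf f0] := ffx.
have wf := in_Vhalf_has_weak_derivative ffx; have [fi fxi _] := wf.
have cjf := within_continuousM (@exp_within_continuous R 0 l j.+1) cf.
have := has_weak_derivative_FTC l0 cjf (has_weak_derivativeM wf (@smooth_exp R j.+1)).
rewrite /= f0 mulr0 subr0 => <-; apply/eqP; rewrite eq_sym subr_eq; apply/eqP.
have i1 := integrable_mul_smooth fxi (@smooth_exp R j.+1).
have i2 := integrable_mul_smooth fi (@smooth_exp R j).
rewrite /moment -RintegralZl// -RintegralD//; last exact: integrableRZ.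
by apply: eq_Rintegral => x _; rewrite derive1_exp /=; ring.
Qed.

Lemma trace_has_weak_derivative T : 0 < T -> has_weak_derivative 0 T (fun t => y t l) z.
Proof. by move=> /(sol_trace sol)[? ? ?]; split => //; exact: in_L2_integrable. Qed.

Lemma has_weak_derivative_moment_y_x0 T : 0 < T ->
  has_weak_derivative 0 T (fun t => moment (y_x t) 0) z.
Proof.
move=> T0; apply: eq_has_weak_derivative (trace_has_weak_derivative T0) => // t /andP[t0 _].
exact/esym/in_Vhalf_moment0/y_in_Vhalf/ltW.
Qed.

(** This is the compatibility equation between [y_x] and [y_t]. The space derivative is first moved
    off [y_x] by [in_Vhalf_momentS]; what remains, the trace and a moment of [y], can be
    differentiated in time. *)
Lemma has_weak_derivative_moment_y_xS j T : 0 < T ->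
  has_weak_derivative 0 T (fun t => moment (y_x t) j.+1)
    (fun t => l ^+ j.+1 * z t - j.+1%:R * moment (y_t t) j).
Proof.
move=> T0.
have h1 := has_weak_derivativeZ (l ^+ j.+1) (trace_has_weak_derivative T0).
have h2 := has_weak_derivativeZ (- j.+1%:R) (has_weak_derivative_moment_y j T0).
apply: eq_has_weak_derivative (has_weak_derivativeD h1 h2) => t /andP[t0 _].
  by rewrite mulNr (in_Vhalf_momentS _ (y_in_Vhalf (ltW t0))).
by rewrite mulNr.
Qed.

Notation g := (delayed_feedback l nu z).

Lemma z_in_L2 T : 0 < T -> in_L2 `]0, T[ z.
Proof. by move=> /(sol_trace sol)[]. Qed.

Lemma z_integrable T : 0 < T -> mu.-integrable `]0, T[ (EFin \o z).
Proof. by move=> T0; exact/in_L2_integrable/z_in_L2. Qed.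

Lemma g_integrable T : 0 < T -> mu.-integrable `]0, T[ (EFin \o g).
Proof.
move=> T0; have zi := (integrable_patch z (measurable_itv `]0, T[)).1 (z_integrable T0).
have zsi := preserves_lebesgue_integrable (preserves_lebesgue_shift (- (2 * l))) zi.
have i1 : mu.-integrable `]0, T[ (EFin \o (fun t => nu * (z \_ `]0, T[) (t - 2 * l))).
  by apply: integrableRZ => //; exact: (integrableS measurableT _ (@subsetT _ _) zsi).
(* The zero extension of [z] from []0, T[], delayed by [2 * l], gives [g] except at [t = 2 * l],
   where [g] already takes the value [nu * z 0]. The indicator restores this point. *)
have i2 : mu.-integrable `]0, T[ (EFin \o (fun t => (nu * z 0) * \1_[set 2 * l] t)).
  apply: integrableRZ => //.
  apply: (@integrableS _ _ _ mu setT) => //.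
  have := @integrable_indic_itv R (2 * l) (2 * l) true false.
  by rewrite set_itv1.
apply: eq_integrableR (integrableRD (measurable_itv _) i1 i2) => // t.
rewrite inE/= in_itv/= => /andP[t0 tT].
rewrite /delayed_feedback patchE mem_setE in_itv/= indicE subr_gt0.
have -> : t - 2 * l < T by rewrite ltrBlDr ltr_wpDr// mulr_ge0// ltW.
rewrite andbT; have [tl|tl|->] := ltgtP t (2 * l).
- by rewrite mulr0 memNset ?mulr0 ?addr0// => /= tl'; rewrite tl' ltxx in tl.
- by rewrite memNset ?mulr0 ?addr0// => /= tl'; rewrite tl' ltxx in tl.
- by rewrite mulr0 mem_set// mulr1 add0r subrr.
Qed.

Lemma exp_in_Vhalf j : in_Vhalf l (fun x => x ^+ j.+1) (fun x => j.+1%:R * x ^+ j).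
Proof.
have c2 : {within `[0, l], continuous (fun x : R => j.+1%:R * x ^+ j)}.
  apply: within_continuousM; first by move=> x; exact: cvg_cst.
  exact: exp_within_continuous.
split; [split|exact: exp_within_continuous|by rewrite expr0n].
- exact: exp_in_L2.
- exact: continuous_in_L2.
- have [] // := @derivable_has_weak_derivative _ 0 l (fun x : R => x ^+ j.+1)
    (fun x : R => j.+1%:R * x ^+ j) l0 (@exp_within_continuous _ _ _ _) c2.
  move=> x _; have := smooth_is_derive x (@smooth_exp R j.+1).
  by rewrite derive1_exp.
Qed.

(** The wave equation tested with [x ^+ j.+1], which vanishes at 0 as [sol_wave] demands; the
    constant function would not be admissible, hence the successor. *)
Lemma has_weak_derivative_moment_y_tS j T : 0 < T ->
  has_weak_derivative 0 T (fun t => moment (y_t t) j.+1)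
    (fun t => l ^+ j.+1 * g t - j.+1%:R * moment (y_x t) j).
Proof.
move=> T0.
have i1 := within_continuous_integrable (@moment_y_t_continuous j.+1 _ T0).
have i2 := within_continuous_integrable (@moment_y_x_continuous j _ T0).
have gi := g_integrable T0.
have i3 : mu.-integrable `]0, T[ (EFin \o (fun t => l ^+ j.+1 * g t)) by exact: integrableRZ.
have i4 : mu.-integrable `]0, T[ (EFin \o (fun t => j.+1%:R * moment (y_x t) j)).
  exact: integrableRZ.
split => //; first exact: integrableRB.
move=> phi tphi; have sphi := test_function_smooth tphi.
have sub : `]0, T[ `<=` `]0, +oo[ by apply: subset_itvl.
have out x : ~ `]0, T[%classic x -> phi x = 0 by move=> /(test_function_outside tphi)[].
have out' x : ~ `]0, T[%classic x -> derive1 phi x = 0.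
  by move=> /(test_function_outside tphi)[].
have := sol_wave sol (exp_in_Vhalf j) (test_function_sub sub tphi).
rewrite !(Rintegral_vanish_outside _ sub)// => h.
have j1 := integrable_mul_smooth i3 sphi.
have j2 := integrable_mul_smooth i4 sphi.
have e3 : \int[mu]_(t in `]0, T[) (g t * l ^+ j.+1 * phi t) =
    \int[mu]_(t in `]0, T[) (l ^+ j.+1 * g t * phi t).
  by apply: eq_Rintegral => t _; rewrite [g t * _]mulrC.
have e4 : \int[mu]_(t in `]0, T[)
      ((\int[mu]_(x in `]0, l[) (y_x t x * (j.+1%:R * x ^+ j))) * phi t) =
    \int[mu]_(t in `]0, T[) (j.+1%:R * moment (y_x t) j * phi t).
  apply: eq_Rintegral => t; rewrite inE/= in_itv/= => /andP[t0 _]; congr (_ * _).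
  have [it _] := L2norm_hoelder (measurable_itv _) (y_x_in_L2 (ltW t0)) (exp_in_L2 0 l j).
  by rewrite -RintegralZl//; apply: eq_Rintegral => x _; rewrite mulrCA.
under [in RHS]eq_Rintegral do rewrite mulrBl.
by rewrite RintegralB// -e3 -e4 -h addrK opprK.
Qed.

(* [(t + x)^n - (t - x)^n], which is tested against [y_t], is odd in [x], and
   [(t + x)^n + (t - x)^n], which is tested against [y_x], is even. *)
Definition signed_moment t j : R :=
  if odd j then moment (y_t t) j else moment (y_x t) j.

Definition boundary_term t j : R := if odd j then g t else z t.

Lemma has_weak_derivative_signed_moment j T : 0 < T ->
  has_weak_derivative 0 T (fun t => signed_moment t j)
    (fun t => l ^+ j * boundary_term t j - j%:R * signed_moment t j.-1).
Proof.
move=> T0; case: j => [|j].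
  apply: eq_has_weak_derivative (has_weak_derivative_moment_y_x0 T0) => // t _.
  by rewrite mul0r subr0 expr0 mul1r.
rewrite /signed_moment /boundary_term /=; case: (odd j) => /=.
  exact: has_weak_derivative_moment_y_xS.
exact: has_weak_derivative_moment_y_tS.
Qed.

(** * Moments along the travelling polynomials *)

Definition travelling_moment n t : R :=
  \sum_(j < n.+1) ('C(n, j)%:R * t ^+ (n - j) * signed_moment t j).

Definition travelling_flux n t : R :=
  \sum_(j < n.+1) ('C(n, j)%:R * t ^+ (n - j) * (l ^+ j * boundary_term t j)).

Lemma has_weak_derivative_travelling_moment n T : 0 < T ->
  has_weak_derivative 0 T (travelling_moment n) (travelling_flux n).
Proof.
move=> T0.
have h (j : 'I_n.+1) := has_weak_derivativeM
  (has_weak_derivativeZ 'C(n, j)%:R (has_weak_derivative_signed_moment j T0))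
  (@smooth_exp R (n - j)).
apply: eq_has_weak_derivative (has_weak_derivative_sum h) => t _ /=.
  by apply: eq_bigr => j _; ring.
under eq_bigr do rewrite derive1_exp.
rewrite /travelling_flux.
(* The interior terms cancel because the polynomials solve the wave equation; in coefficients,
   ['C(n, j) * (n - j) = 'C(n, j.+1) * j.+1]. The last term on the left and the first on the right
   are zero, so the indices match after a shift by one. *)
have tele : \sum_(j < n.+1) ('C(n, j)%:R * (n - j)%:R * t ^+ (n - j).-1 * signed_moment t j) =
    \sum_(j < n.+1) ('C(n, j)%:R * j%:R * t ^+ (n - j) * signed_moment t j.-1).
  rewrite big_ord_recr big_ord_recl /= subnn mulr0 !mul0r addr0 mulr0 !mul0r add0r.
  apply: eq_bigr => j _; rewrite /bump/= add1n subnS -!natrM.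
  by rewrite mulnC -mul_bin_left mulnC.
apply/eqP; rewrite -subr_eq0 -sumrB.
rewrite (eq_bigr (fun j : 'I_n.+1 =>
  'C(n, j)%:R * (n - j)%:R * t ^+ (n - j).-1 * signed_moment t j -
  'C(n, j)%:R * j%:R * t ^+ (n - j) * signed_moment t j.-1)); last first.
  by move=> j _; ring.
by rewrite sumrB tele subrr.
Qed.

Lemma signed_moment_continuous j T : 0 < T ->
  {within `[0, T], continuous (fun t => signed_moment t j)}.
Proof.
move=> T0; rewrite /signed_moment; case: (odd j).
  exact: moment_y_t_continuous.
exact: moment_y_x_continuous.
Qed.

Lemma travelling_moment_continuous n T : 0 < T ->
  {within `[0, T], continuous (travelling_moment n)}.
Proof.
move=> T0; rewrite /travelling_moment; elim: n.+1 => [|k IH].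
  by rewrite (_ : (fun t => _) = cst 0); [move=> x; exact: cvg_cst|
    apply/funext => t; rewrite big_ord0].
rewrite (_ : (fun t => _) = (fun t => (\sum_(j < k) ('C(n, j)%:R * t ^+ (n - j) * signed_moment t j)) +
  'C(n, k)%:R * t ^+ (n - k) * signed_moment t k)); last first.
  by apply/funext => t; rewrite big_ord_recr.
apply: within_continuousD => //; apply: within_continuousM; last exact: signed_moment_continuous.
apply: within_continuousM; first by move=> x; exact: cvg_cst.
exact: exp_within_continuous.
Qed.

Lemma travelling_moment_balance n t1 t2 : 0 <= t1 -> t1 < t2 ->
  travelling_moment n t2 - travelling_moment n t1 =
  \int[mu]_(t in `]t1, t2[) travelling_flux n t.
Proof.
move=> t10 t12; have t20 := le_lt_trans t10 t12.
apply/esym/has_weak_derivative_FTC => //.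
  apply: (@continuous_subspaceW _ _ `[t1, t2] `[0, t2]).
    by apply: subset_itvr; rewrite bnd_simp.
  exact: travelling_moment_continuous.
exact: has_weak_derivative_subset (has_weak_derivative_travelling_moment n t20).
Qed.

Lemma travelling_fluxE n t : 2 * travelling_flux n t =
  (t + l) ^+ n * (g t + z t) + (t - l) ^+ n * (z t - g t).
Proof.
rewrite exprDn exprBn !mulr_suml -big_split mulr_sumr/=.
apply: eq_bigr => j _; rewrite /boundary_term -signr_odd -[t ^+ _ * _ *+ _]mulr_natl.
rewrite -[_ * _ * _ *+ _]mulr_natl.
by case: (odd j); rewrite ?expr1 ?expr0; ring.
Qed.

Lemma travelling_momentE n t : 0 <= t -> 2 * travelling_moment n t =
  \int[mu]_(x in `]0, l[) ((t + x) ^+ n * (y_t t x + y_x t x) +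
                           (t - x) ^+ n * (y_x t x - y_t t x)).
Proof.
move=> t0; pose w j := if odd j then y_t t else y_x t.
have wi j : mu.-integrable `]0, l[ (EFin \o (fun x => w j x * x ^+ j)).
  rewrite /w; case: (odd j).
    by have [] := L2norm_hoelder (measurable_itv _) (y_t_in_L2 t0) (exp_in_L2 0 l j).
  by have [] := L2norm_hoelder (measurable_itv _) (y_x_in_L2 t0) (exp_in_L2 0 l j).
have wi' j : mu.-integrable `]0, l[
    (EFin \o (fun x => 2 * 'C(n, j)%:R * t ^+ (n - j) * (w j x * x ^+ j))).
  exact: integrableRZ.
transitivity (\int[mu]_(x in `]0, l[)
    \sum_(j < n.+1) (2 * 'C(n, j)%:R * t ^+ (n - j) * (w j x * x ^+ j))).
  have [_ ->] := Rintegral_sum n.+1 (measurable_itv `]0, l[) wi'.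
  rewrite mulr_sumr; apply: eq_bigr => j _; rewrite RintegralZl// !mulrA.
  by congr (_ * _); rewrite /signed_moment /w; case: (odd j).
apply: eq_Rintegral => x _.
rewrite exprDn exprBn !mulr_suml -big_split/=.
apply: eq_bigr => j _; rewrite /w -signr_odd -[t ^+ _ * _ *+ _]mulr_natl.
rewrite -[_ * _ * _ *+ _]mulr_natl.
by case: (odd j); rewrite ?expr1 ?expr0; ring.
Qed.

(** The directions are relative to the end [x = l]: in terms of P = p', [outgoing s] is
    [2 P(s + l)], the wave sent back into the interval, and [incoming s] is [2 P(s - l)], the wave
    arriving there. *)
Definition outgoing s : R := g s + z s.

Definition incoming s : R := g s - z s.

(** Right and left refer to the halves of the window centred at [t], not to directions of
    propagation: [y_t + y_x] is [2 P(t + x)] and fills []t, t + l[], while [y_x - y_t] is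
    [2 P(t - x)] and fills []t - l, t[]. *)
Definition wave_right t : R -> R := (fun x => y_t t x + y_x t x) \_ `]0, l[.

Definition wave_left t : R -> R := (fun x => y_x t x - y_t t x) \_ `]0, l[.

(* The restriction to [`]t - l, t + l[] of [2 p'], where
   [y(x, t) = p(t + x) - p(t - x)]. *)
Definition profile t s : R := wave_right t (s - t) + wave_left t (t - s).

Lemma wave_right_integrable t : 0 <= t ->
  mu.-integrable `]0, l[ (EFin \o (fun x => y_t t x + y_x t x)).
Proof.
move=> t0; apply: integrableRD => //; apply: in_L2_integrable.
  exact: y_t_in_L2.
exact: y_x_in_L2.
Qed.

Lemma wave_left_integrable t : 0 <= t ->
  mu.-integrable `]0, l[ (EFin \o (fun x => y_x t x - y_t t x)).
Proof.
move=> t0; apply: integrableRB => //; apply: in_L2_integrable.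
  exact: y_x_in_L2.
exact: y_t_in_L2.
Qed.

Lemma profile_moment n t : 0 <= t ->
  mu.-integrable setT (EFin \o (fun s => s ^+ n * profile t s)) /\
  \int[mu]_s (s ^+ n * profile t s) = 2 * travelling_moment n t.
Proof.
move=> t0.
have [i1 I1] := @exp_patch_shift R 0 l t 1 _ n (expr1n _ _) (wave_right_integrable t0).
have [i2 I2] := @exp_patch_shift R 0 l t (-1) _ n (sqrr_sign _ 1) (wave_left_integrable t0).
have E : (fun s => s ^+ n * profile t s) = (fun s =>
    s ^+ n * wave_right t (1 * (s - t)) + s ^+ n * wave_left t (-1 * (s - t))).
  by apply/funext => s; rewrite -mulrDr mul1r mulN1r opprB.
split; first by rewrite E; exact: integrableRD.
rewrite E RintegralD// I1 I2 -RintegralD//.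
- by rewrite travelling_momentE//; apply: eq_Rintegral => x _; rewrite mul1r mulN1r ![_ + t]addrC.
- have := integrable_mul_smooth (wave_right_integrable t0) (@smooth_affine_exp R 1 t n).
  by apply: eq_integrableR => // x _; rewrite mulrC.
- have := integrable_mul_smooth (wave_left_integrable t0) (@smooth_affine_exp R (-1) t n).
  by apply: eq_integrableR => // x _; rewrite mulrC.
Qed.

Lemma outgoing_integrable t1 t2 : 0 <= t1 -> t1 < t2 ->
  mu.-integrable `]t1, t2[ (EFin \o outgoing).
Proof.
move=> t10 t12; have t20 := le_lt_trans t10 t12.
apply: (@integrableS _ _ _ mu `]0, t2[) => //; first by apply: subset_itvr; rewrite bnd_simp.
by apply: integrableRD => //; [exact: g_integrable|exact: z_integrable].
Qed.

Lemma incoming_integrable t1 t2 : 0 <= t1 -> t1 < t2 ->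
  mu.-integrable `]t1, t2[ (EFin \o incoming).
Proof.
move=> t10 t12; have t20 := le_lt_trans t10 t12.
apply: (@integrableS _ _ _ mu `]0, t2[) => //; first by apply: subset_itvr; rewrite bnd_simp.
by apply: integrableRB => //; [exact: g_integrable|exact: z_integrable].
Qed.

Lemma profile_outside t s : ~~ (t - l < s < t + l) -> profile t s = 0.
Proof.
move=> h; rewrite /profile /wave_right /wave_left !patchE !mem_setE !in_itv/=.
case: ifPn => [/andP[a b]|_].
  by case/negP: h; apply/andP; split; move: l0; lra.
case: ifPn => [/andP[a b]|_]; last by rewrite addr0.
by case/negP: h; apply/andP; split; move: l0; lra.
Qed.

(** The defect in the conservation of travelling moments, written as one compactly supported
    function of [s]: after substituting [s = t + x], [s = t - x] and [s = t + l], [s = t - l], every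
    moment identity has the same weight [s ^+ n]. *)
Definition balance t1 t2 s : R := profile t2 s - profile t1 s -
  ((outgoing \_ `]t1, t2[) (s - l) - (incoming \_ `]t1, t2[) (s + l)).

Lemma balance_ae0 t1 t2 : 0 <= t1 -> t1 < t2 ->
  {ae mu, forall s, t1 - l < s < t2 + l -> balance t1 t2 s = 0}.
Proof.
move=> t10 t12; have t20 := ltW (le_lt_trans t10 t12).
have key n : mu.-integrable setT (EFin \o (fun s => s ^+ n * balance t1 t2 s)) /\
    \int[mu]_s (s ^+ n * balance t1 t2 s) = 0.
  have [i1 I1] := profile_moment n t10; have [i2 I2] := profile_moment n t20.
  have oi := outgoing_integrable t10 t12; have ii := incoming_integrable t10 t12.
  have [i3 I3] := @exp_patch_shift R t1 t2 l 1 _ n (expr1n _ _) oi.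
  have [i4 I4] := @exp_patch_shift R t1 t2 (- l) 1 _ n (expr1n _ _) ii.
  have E : (fun s => s ^+ n * balance t1 t2 s) = (fun s =>
      s ^+ n * profile t2 s - s ^+ n * profile t1 s -
      (s ^+ n * (outgoing \_ `]t1, t2[) (1 * (s - l)) -
       s ^+ n * (incoming \_ `]t1, t2[) (1 * (s - - l)))).
    by apply/funext => s; rewrite !mul1r opprK -!mulrBr.
  have i21 := integrableRB measurableT i2 i1.
  have i34 := integrableRB measurableT i3 i4.
  split; first by rewrite E; exact: integrableRB.
  rewrite E RintegralB// RintegralB// RintegralB// I1 I2 I3 I4.
  rewrite -mulrBr travelling_moment_balance// -RintegralZl//; last first.
    by have [] := has_weak_derivative_subset t10 (lexx t2)
      (has_weak_derivative_travelling_moment n (le_lt_trans t10 t12)).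
  apply/eqP; rewrite subr_eq0; apply/eqP; rewrite -RintegralB//.
  - apply: eq_Rintegral => s _; rewrite travelling_fluxE !mul1r /outgoing /incoming.
    by rewrite -mulrN opprB.
  - have := integrable_mul_smooth oi (@smooth_affine_exp R 1 l n).
    by apply: eq_integrableR => // x _; rewrite mulrC.
  - have := integrable_mul_smooth ii (@smooth_affine_exp R 1 (- l) n).
    by apply: eq_integrableR => // x _; rewrite mulrC.
have out s : ~~ (t1 - l < s < t2 + l) -> balance t1 t2 s = 0.
  move=> h; rewrite /balance profile_outside; last first.
    by apply: contra h => /andP[? ?]; apply/andP; split; lra.
  rewrite profile_outside; last first.
    by apply: contra h => /andP[? ?]; apply/andP; split; lra.
  rewrite !patchE !mem_setE !in_itv/= ifF; last first.
    by apply/negP => /andP[? ?]; case/negP: h; apply/andP; split; move: l0; lra.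
  rewrite ifF ?subrr//.
  by apply/negP => /andP[? ?]; case/negP: h; apply/andP; split; move: l0; lra.
apply: moments_ae0 => [|n].
  have [+ _] := key 0%N; rewrite (_ : (fun s => _) = balance t1 t2); last first.
    by apply/funext => s; rewrite mul1r.
  by move=> bi; apply: (@integrableS _ _ _ mu setT).
have [_ <-] := key n; rewrite Rintegral_mkcond; congr Rintegral; apply/funext => s.
rewrite patchE mem_setE in_itv/=; case: ifPn => // /out ->.
by rewrite mulr0.
Qed.

(** Take [t2 = t + 2 * l]. On []t - l, t + l[] the later profile and the outgoing term both vanish,
    and [balance] reduces to two terms. The adjacent window gives [profile_outgoing] in the same
    way. *)
Lemma profile_incoming t : 0 <= t ->
  {ae mu, forall s, t - l < s < t + l -> profile t s = incoming (s + l)}.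
Proof.
move=> t0; have t12 : t < t + 2 * l by move: l0; lra.
apply: filterS (balance_ae0 t0 t12); first exact: (ae_filter_ringOfSetsType mu).
move=> s + /andP[s1 s2]; rewrite /balance profile_outside; last first.
  by apply/negP => /andP[? ?]; move: l0; lra.
rewrite !patchE !mem_setE !in_itv/= ifF; last first.
  by apply/negP => /andP[? ?]; move: l0; lra.
rewrite ifT; last by apply/andP; split; move: l0; lra.
rewrite !sub0r opprK => h; apply/eqP; rewrite eq_sym -subr_eq0 addrC h//.
by apply/andP; split; move: l0; lra.
Qed.

Lemma profile_outgoing t : 0 <= t -> {ae mu, forall s, t + l < s < t + 3 * l ->
  profile (t + 2 * l) s = outgoing (s - l)}.
Proof.
move=> t0; have t12 : t < t + 2 * l by move: l0; lra.
apply: filterS (balance_ae0 t0 t12); first exact: (ae_filter_ringOfSetsType mu).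
move=> s + /andP[s1 s2]; rewrite /balance (@profile_outside t); last first.
  by apply/negP => /andP[? ?]; move: l0; lra.
rewrite !patchE !mem_setE !in_itv/= ifT; last by apply/andP; split; move: l0; lra.
rewrite ifF; last by apply/negP => /andP[? ?]; move: l0; lra.
rewrite !subr0 => h; apply/eqP; rewrite -subr_eq0 h//.
by apply/andP; split; move: l0; lra.
Qed.

Lemma wave_right_sqr_integrable t : 0 <= t ->
  mu.-integrable `]0, l[ (EFin \o (fun x => (y_t t x + y_x t x) ^+ 2)).
Proof.
move=> t0; apply: in_L2_sqr_integrable => //.
have := in_L2B (y_t_in_L2 t0) (in_L2Z (-1) (y_x_in_L2 t0)).
by congr in_L2; apply/funext => x /=; rewrite mulN1r opprK.
Qed.

Lemma wave_left_sqr_integrable t : 0 <= t ->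
  mu.-integrable `]0, l[ (EFin \o (fun x => (y_x t x - y_t t x) ^+ 2)).
Proof.
move=> t0; apply: in_L2_sqr_integrable => //.
exact: in_L2B (y_x_in_L2 t0) (y_t_in_L2 t0).
Qed.

Lemma profile_sqr t : 0 <= t -> mu.-integrable setT (EFin \o (fun s => profile t s ^+ 2)) /\
  \int[mu]_s profile t s ^+ 2 = 4 * energy l y_x y_t t.
Proof.
move=> t0; have ri := wave_right_sqr_integrable t0; have li := wave_left_sqr_integrable t0.
have [i1 I1] := @exp_patch_shift R 0 l t 1 _ 0 (expr1n _ _) ri.
have [i2 I2] := @exp_patch_shift R 0 l t (-1) _ 0 (sqrr_sign _ 1) li.
(* The square of the sum has no cross term, since the two waves have disjoint supports. The factors
   [s ^+ 0] put it in the form of [exp_patch_shift] with [n = 0]. *)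
have E : (fun s => profile t s ^+ 2) = (fun s =>
    s ^+ 0 * ((fun x => (y_t t x + y_x t x) ^+ 2) \_ `]0, l[) (1 * (s - t)) +
    s ^+ 0 * ((fun x => (y_x t x - y_t t x) ^+ 2) \_ `]0, l[) (-1 * (s - t))).
  apply/funext => s; rewrite !mul1r mulN1r opprB /profile /wave_right /wave_left.
  rewrite !patchE !mem_setE !in_itv/=; case: ifPn => [/andP[a b]|_].
    have -> : (0 < t - s < l) = false by apply/negP => /andP[? ?]; lra.
    by rewrite !addr0.
  by rewrite !add0r; case: ifP => // _; rewrite expr0n.
split; first by rewrite E; exact: integrableRD.
rewrite E RintegralD// I1 I2 /energy -RintegralD//.
- rewrite mulrA (_ : 4 * 2^-1 = 2); last by field.
  have xi := in_L2_sqr_integrable (measurable_itv _) (y_x_in_L2 t0).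
  have ti := in_L2_sqr_integrable (measurable_itv _) (y_t_in_L2 t0).
  rewrite -RintegralZl//; last exact: integrableRD.
  by apply: eq_Rintegral => x _; rewrite !expr0; ring.
- by apply: eq_integrableR ri => // x _; rewrite expr0 mul1r.
- by apply: eq_integrableR li => // x _; rewrite expr0 mul1r.
Qed.

(** Energies at all times become integrals of one function over a sliding window of length [2 * l],
    so that they can be compared through pointwise bounds on [incoming]. *)
Lemma incoming_sqr t : 0 <= t ->
  mu.-integrable `]t, t + 2 * l[ (EFin \o (fun s => incoming s ^+ 2)) /\
  \int[mu]_(s in `]t, t + 2 * l[) incoming s ^+ 2 = 4 * energy l y_x y_t t.
Proof.
move=> t0; have t12 : t < t + 2 * l by move: l0; lra.
have [pi pE] := profile_sqr t0.
have e1 : t + 2 * l - l = t + l by ring.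
have [ii _] := Rintegral_itv_shift l (incoming_integrable t0 t12).
rewrite e1 in ii.
have pi' : mu.-integrable `]t - l, t + l[ (EFin \o (fun s => profile t s ^+ 2)).
  exact: (@integrableS _ _ _ mu setT).
have mi : measurable_fun (`]t - l, t + l[%classic : set (measurableTypeR R))
    (fun s => incoming (s + l) ^+ 2).
  by apply: measurable_funX; exact: integrableR_measurable ii.
have [] := ae_eq_Rintegral (measurable_itv _) mi pi'.
  apply: filterS (profile_incoming t0); first exact: (ae_filter_ringOfSetsType mu).
  by move=> s + /=; rewrite in_itv/= => h /h ->.
move=> i3 I3.
have [] := Rintegral_itv_shift (- l) i3.
have e2 : t + l + l = t + 2 * l by ring.
rewrite !opprK subrK e2.
have E : (fun s : R => incoming (s - l + l) ^+ 2) = (fun s => incoming s ^+ 2).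
  by apply/funext => s; rewrite subrK.
rewrite E => i4 I4; split => //; rewrite I4 -I3 -pE [RHS]Rintegral_mkcond Rintegral_mkcond.
congr Rintegral; apply/funext => s; rewrite !patchE mem_setE in_itv/= in_setT.
by case: ifPn => // /profile_outside ->; rewrite expr0n.
Qed.

(** A wave leaving [x = l] is reflected at [x = 0] and returns after the travel time [2 * l]. Both
    sides equal the profile at time [t + 2 * l]. *)
Lemma incoming_shift t : 0 <= t ->
  {ae mu, forall s, t < s < t + 2 * l -> incoming (s + 2 * l) = outgoing s}.
Proof.
move=> t0; have t20 : 0 <= t + 2 * l by move: l0; lra.
have h : {ae mu, forall s, t + l < s < t + 3 * l -> incoming (s + l) = outgoing (s - l)}.
  have FF := ae_filter_ringOfSetsType mu.
  apply: filterS2 (profile_outgoing t0) (profile_incoming t20) => s h1 h2 sl.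
  by rewrite -h1// h2//; move/andP: sl => [? ?]; apply/andP; split; lra.
have := preserves_lebesgue_ae (preserves_lebesgue_shift l) h.
have FF := ae_filter_ringOfSetsType mu.
apply: filterS.
have e2 s : s + l + l = s + 2 * l by ring.
move=> s + /andP[s1 s2]; rewrite addrK e2; apply.
by apply/andP; split; lra.
Qed.

(** After two round trips the value is [g + z] at [s + 2 * l], that is [2 * nu * z s - outgoing s].
    Since [2 * z s] is [outgoing s - incoming s], only the two previous values of [incoming]
    remain. *)
Lemma incoming_recursion t : 0 <= t -> {ae mu, forall s, t < s < t + 2 * l ->
  incoming (s + 2 * l + 2 * l) = - (1 - nu) * incoming (s + 2 * l) - nu * incoming s}.
Proof.
move=> t0; have t20 : 0 <= t + 2 * l by move: l0; lra.
have h := preserves_lebesgue_ae (preserves_lebesgue_shift (2 * l)) (incoming_shift t20).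
have FF := ae_filter_ringOfSetsType mu.
apply: filterS2 (incoming_shift t0) h => s h1 h2 /andP[s1 s2].
have gE : g (s + 2 * l) = nu * z s.
  by rewrite /delayed_feedback ifF ?addrK//; apply/negP => ?; lra.
have e1 := h1 _; have e2 := h2 _.
have {}e1 : incoming (s + 2 * l) = outgoing s by apply: e1; apply/andP.
have {}e2 : incoming (s + 2 * l + 2 * l) = outgoing (s + 2 * l).
  by apply: e2; apply/andP; split; lra.
have e3 : z (s + 2 * l) = nu * z s - outgoing s by rewrite -e1 /incoming gE; ring.
by rewrite e2 e1 {1}/outgoing gE e3 /outgoing /incoming; ring.
Qed.

(** With the feedback off, both waves reduce to the trace velocity up to sign. The two starting
    values of the recursion thus depend on one. *)
Lemma incoming_start : {ae mu, forall s, 0 < s < 2 * l -> incoming (s + 2 * l) = - incoming s}.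
Proof.
apply: filterS (incoming_shift (lexx 0)); first exact: (ae_filter_ringOfSetsType mu).
move=> s; rewrite add0r => h sl; rewrite h//; move/andP: sl => [s1 s2].
by rewrite /outgoing /incoming /delayed_feedback s2 add0r sub0r opprK.
Qed.

End moment_equations.

(** * Exponential decay *)

Section lyapunov.
Context {R : realType} (nu : R).
Hypotheses (nu0 : 0 < nu) (nu1 : nu < 1).

(** The value for which the cross coefficient of [lyapunov] is preserved by one step: it solves
    [2 * nu * (1 - nu) - nu * gap = gap]. *)
Definition gap : R := 2 * nu * (1 - nu) / (1 + nu).

(* The weight of [v ^+ 2] and of [u * v] are tuned so that one step of the
   recursion [(u, v) |-> (- (1 - nu) * u - nu * v, u)] decreases the form by
   exactly [gap * (u ^+ 2 + v ^+ 2)]. *)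
Definition lyapunov (u v : R) : R := u ^+ 2 + (nu ^+ 2 + gap) * v ^+ 2 + gap * u * v.

(** By [lyapunov_le], the loss [gap * (u ^+ 2 + v ^+ 2)] is at least the fraction [gap / 3] of the
    form. *)
Definition rate : R := 1 - gap / 3.

Lemma gap_gt0 : 0 < gap.
Proof. by rewrite divr_gt0 ?mulr_gt0 ?subr_gt0// ltr_wpDr// ltW. Qed.

Lemma gap_lt1 : gap < 1.
Proof.
rewrite /gap ltr_pdivrMr ?addr_gt0// mul1r -subr_gt0.
by rewrite (_ : _ - _ = 2 * nu ^+ 2 + (1 - nu));
  [rewrite ltr_wpDl ?subr_gt0// mulr_ge0// sqr_ge0|ring].
Qed.

Lemma sqr_nu_le1 : nu ^+ 2 <= 1.
Proof. by rewrite exprn_ile1// ltW. Qed.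

Lemma rate_gt0 : 0 < rate.
Proof. by have := gap_lt1; rewrite /rate => ?; lra. Qed.

Lemma rate_lt1 : rate < 1.
Proof. by have := gap_gt0; rewrite /rate => ?; lra. Qed.

Lemma lyapunov_step (u v : R) :
  lyapunov (- (1 - nu) * u - nu * v) u = lyapunov u v - gap * (u ^+ 2 + v ^+ 2).
Proof.
by rewrite /lyapunov /gap; field; rewrite gt_eqF// addr_gt0.
Qed.

Lemma lyapunov_le (u v : R) : lyapunov u v <= 3 * (u ^+ 2 + v ^+ 2).
Proof.
have := gap_gt0; have := gap_lt1; rewrite /lyapunov; move: gap => k k1 k0.
have h1 : k * u * v <= (u ^+ 2 + v ^+ 2) / 2.
  have h : 0 <= (u - v) ^+ 2 by exact: sqr_ge0.
  have h' : 0 <= (u + v) ^+ 2 by exact: sqr_ge0.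
  by nra.
have h2 : (nu ^+ 2 + k) * v ^+ 2 <= 2 * v ^+ 2.
  by rewrite ler_wpM2r ?sqr_ge0//; have := sqr_nu_le1; lra.
have := sqr_ge0 u; have := sqr_ge0 v; lra.
Qed.

(** Complete the square in [u]. Only [v] is kept, since with [(u, v) = (a n.+1, a n)] it is the term
    to be bounded. *)
Lemma lyapunov_ge (u v : R) : gap / 2 * v ^+ 2 <= lyapunov u v.
Proof.
have := gap_gt0; have := gap_lt1; rewrite /lyapunov; move: gap => k k1 k0.
rewrite -subr_ge0 (_ : _ - _ = (u + k / 2 * v) ^+ 2 + (nu ^+ 2 + k / 2 * (1 - k / 2)) * v ^+ 2);
  last by field.
by rewrite addr_ge0 ?sqr_ge0// mulr_ge0 ?sqr_ge0// addr_ge0 ?sqr_ge0// mulr_ge0; lra.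
Qed.

(** The constant is the initial bound 2, where the cross term cancels one [gap], divided by the
    coercivity constant [gap / 2]. *)
Lemma recursion_decay (a : nat -> R) : a 1%N = - a 0%N ->
  (forall n, a n.+2 = - (1 - nu) * a n.+1 - nu * a n) ->
  forall n, a n ^+ 2 <= 4 / gap * rate ^+ n * a 0%N ^+ 2.
Proof.
move=> a1 aS n; have g0 := gap_gt0.
have dec : lyapunov (a n.+1) (a n) <= rate ^+ n * lyapunov (a 1%N) (a 0%N).
  elim: n => [|n IH]; first by rewrite expr0 mul1r.
  rewrite aS lyapunov_step.
  apply: (@le_trans _ _ (rate * lyapunov (a n.+1) (a n))).
    rewrite /rate mulrBl mul1r lerD2l lerN2 -mulrA ler_wpM2l ?(ltW g0)//.
    by rewrite ler_pdivrMl// lyapunov_le.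
  by rewrite [rate ^+ n.+1]exprS -mulrA ler_wpM2l// ltW// rate_gt0.
have start : lyapunov (a 1%N) (a 0%N) <= 2 * a 0%N ^+ 2.
  rewrite a1 /lyapunov (_ : _ + _ = (1 + nu ^+ 2) * a 0%N ^+ 2); last by ring.
  by rewrite ler_wpM2r ?sqr_ge0//; have := sqr_nu_le1; lra.
have rn : 0 <= rate ^+ n by rewrite exprn_ge0// ltW// rate_gt0.
have := lyapunov_ge (a n.+1) (a n).
have := ler_wpM2l rn start => h1 h2.
have h3 := le_trans h2 (le_trans dec h1).
have g2 : 0 < gap / 2 by rewrite divr_gt0.
rewrite -(ler_pM2l g2); apply: (le_trans h3).
rewrite le_eqVlt; apply/orP; left; apply/eqP; field.
by rewrite gt_eqF.
Qed.

End lyapunov.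

(** * Transfer of the decay to the energy *)

Section energy_decay.
Context {R : realType}.
Notation mu := (@lebesgue_measure R).

Context (l nu : R) (y0 y1 : R -> R) (y y_x y_t : R -> R -> R) (z : R -> R).
Hypothesis l0 : 0 < l.
Hypotheses (nu0 : 0 < nu) (nu1 : nu < 1).
Hypothesis sol : weak_solution l nu y0 y1 y y_x y_t z.

Notation E := (energy l y_x y_t).
Notation r := (incoming l nu z).

Lemma energy_ge0 t : 0 <= E t.
Proof.
by rewrite mulr_ge0 ?invr_ge0// Rintegral_ge0// => x _; rewrite addr_ge0 ?sqr_ge0.
Qed.

Lemma incoming_decay : {ae mu, forall s, 0 < s < 2 * l -> forall k : nat,
  r (s + k%:R * (2 * l)) ^+ 2 <= 4 / gap nu * rate nu ^+ k * r s ^+ 2}.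
Proof.
have FF := ae_filter_ringOfSetsType mu.
have rec : {ae mu, forall s, forall k : nat, 0 < s < 2 * l ->
    r (s + k.+2%:R * (2 * l)) =
    - (1 - nu) * r (s + k.+1%:R * (2 * l)) - nu * r (s + k%:R * (2 * l))}.
  (* One null set must serve all [k], because the recursion is followed along the whole orbit of a
     fixed [s]. *)
  apply: ae_foralln => k.
  have k0 : 0 <= k%:R * (2 * l) by rewrite mulr_ge0// mulr_ge0// ltW.
  have := preserves_lebesgue_ae (preserves_lebesgue_shift (k%:R * (2 * l)))
    (incoming_recursion l0 sol k0).
  apply: filterS => s h /andP[s1 s2].
  have -> : s + k.+2%:R * (2 * l) = s + k%:R * (2 * l) + 2 * l + 2 * l.
    by rewrite -!(@natr1 R); ring.
  have -> : s + k.+1%:R * (2 * l) = s + k%:R * (2 * l) + 2 * l by rewrite -!(@natr1 R); ring.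
  by apply: h; apply/andP; split; lra.
apply: filterS2 rec (incoming_start l0 sol) => s h1 h2 sl k.
have := @recursion_decay R nu nu0 nu1 (fun k => r (s + k%:R * (2 * l))) _ _ k.
rewrite !mul0r addr0 mul1r; apply; first exact: h2.
by move=> n; exact: h1.
Qed.

Lemma energy_decay_discrete (k : nat) :
  E (k%:R * (2 * l)) <= 4 / gap nu * rate nu ^+ k * E 0.
Proof.
have k0 : 0 <= k%:R * (2 * l) by rewrite mulr_ge0// mulr_ge0// ltW.
have [i1 I1] := incoming_sqr l0 sol k0.
have [i0 I0] := incoming_sqr l0 sol (lexx 0).
rewrite add0r in i0 I0.
have [] := Rintegral_itv_shift (k%:R * (2 * l)) i1.
rewrite subrr addrAC subrr add0r I1 => j1 J1.
have p4 : 0 < 4 :> R by [].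
rewrite -(ler_pM2l p4) -J1 [4 * (_ * E 0)]mulrCA -I0 -RintegralZl//.
apply: ae_le_Rintegral => //; first exact: integrableRZ.
have FF := ae_filter_ringOfSetsType mu.
by apply: filterS incoming_decay => s h; rewrite /= in_itv/= => /h.
Qed.

(** The window starting at [t] is covered by two consecutive windows starting at multiples of
    [2 * l], which doubles [4 / gap] to [8 / gap]. The factor [1 / rate] pays for rounding
    [t / (2 * l)] down to an integer. *)
Lemma energy_decay t : 0 <= t ->
  E t <= 8 / gap nu / rate nu * E 0 * expR (ln (rate nu) / (2 * l) * t).
Proof.
move=> t0; have T0 : 0 < 2 * l by rewrite mulr_gt0.
have r0 := rate_gt0 nu0 nu1; have r1 := rate_lt1 nu0 nu1; have g0 := gap_gt0 nu0 nu1.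
pose k := Num.truncn (t / (2 * l)).
have /andP[kt tk] : k%:R <= t / (2 * l) < k.+1%:R by rewrite truncn_itv// divr_ge0// ltW.
have kt' : k%:R * (2 * l) <= t by rewrite -ler_pdivlMr.
have tk' : t < k.+1%:R * (2 * l) by rewrite -ltr_pdivrMr.
have cover : E t <= E (k%:R * (2 * l)) + E (k.+1%:R * (2 * l)).
  have k0 : 0 <= k%:R * (2 * l) by rewrite mulr_ge0// ltW.
  have k1 : 0 <= k.+1%:R * (2 * l) by rewrite mulr_ge0// ltW.
  have [i1 I1] := incoming_sqr l0 sol t0.
  have [i2 I2] := incoming_sqr l0 sol k0.
  have [i3 I3] := incoming_sqr l0 sol k1.
  have p4 : 0 < 4 :> R by [].
rewrite -(ler_pM2l p4) mulrDr -I1 -I2 -I3.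
  have e : k%:R * (2 * l) + 2 * l = k.+1%:R * (2 * l) by rewrite -natr1; ring.
  rewrite e in i2 *; apply: le_Rintegral_cover => //.
    by move=> x; exact: sqr_ge0.
  by rewrite lerD2r ltW.
have dk := energy_decay_discrete k; have dk1 := energy_decay_discrete k.+1.
have E00 := energy_ge0 0.
have rk : 0 <= rate nu ^+ k by rewrite exprn_ge0// ltW.
have step : E t <= 8 / gap nu * rate nu ^+ k * E 0.
  apply: (le_trans cover); apply: (le_trans (lerD dk dk1)).
  have : 4 / gap nu * rate nu ^+ k.+1 * E 0 <= 4 / gap nu * rate nu ^+ k * E 0.
    apply: ler_wpM2r => //; apply: ler_wpM2l; first by rewrite divr_ge0// ltW.
    by rewrite exprS ler_piMl// ltW.
  have -> : 8 / gap nu = 4 / gap nu + 4 / gap nu by field; rewrite gt_eqF.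
  by rewrite !mulrDl => h; rewrite lerD2l.
apply: (le_trans step).
(* Multiplying [t / (2 * l) - 1 < k] by the negative number [ln (rate nu)] reverses the
   inequality. *)
have rate_exp : rate nu ^+ k <= (rate nu)^-1 * expR (ln (rate nu) / (2 * l) * t).
  have -> : rate nu ^+ k = expR (k%:R * ln (rate nu)) by rewrite expRM_natl lnK.
  rewrite -{2}(@lnK _ (rate nu)) ?posrE// -expRN -expRD ler_expR.
  have ln0 : ln (rate nu) < 0 by rewrite ln_lt0// r0.
  have -> : ln (rate nu) / (2 * l) * t = ln (rate nu) * (t / (2 * l)) by ring.
  rewrite -[X in - X]mulr1 -mulrN -mulrDr [_%:R * _]mulrC ler_wnM2l ?(ltW ln0)//.
  by rewrite addrC lerBlDr natr1 ltW.
have c0 : 0 <= 8 / gap nu * E 0 by rewrite mulr_ge0// divr_ge0// ltW.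
have := ler_wpM2l c0 rate_exp.
rewrite (_ : 8 / gap nu * E 0 * rate nu ^+ k = 8 / gap nu * rate nu ^+ k * E 0); last by ring.
move=> /le_trans; apply; rewrite le_eqVlt; apply/orP; left; apply/eqP; ring.
Qed.

End energy_decay.

(** * The initial energy in terms of the data *)

Section initial_energy.
Context {R : realType} (l : R).
Notation mu := (@lebesgue_measure R).
Hypothesis l0 : 0 < l.
Implicit Types (f fx h hx : R -> R).

(** Integration by parts gives [fx - hx] the moments of a mass [f l - h l] placed at [l]. Such a
    mass is excluded without comparing the endpoint values, about which an almost-everywhere
    equality says nothing directly. *)
Lemma in_Vhalf_derivative_unique f fx h hx : in_Vhalf l f fx -> in_Vhalf l h hx ->
  {ae mu, forall x, x \in `]0, l[ -> f x = h x} ->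
  {ae mu, forall x, `]0, l[%classic x -> fx x = hx x}.
Proof.
move=> Vf Vh fh; have FF := ae_filter_ringOfSetsType mu.
have [fi fxi _] := in_Vhalf_has_weak_derivative Vf.
have [hi hxi _] := in_Vhalf_has_weak_derivative Vh.
have mom n : moment l f n = moment l h n.
  have fni := integrable_mul_smooth fi (@smooth_exp R n).
  have hni := integrable_mul_smooth hi (@smooth_exp R n).
  have [] // := ae_eq_Rintegral (measurable_itv `]0, l[) (integrableR_measurable hni) fni.
  by apply: filterS fh => x fhx x0l; rewrite fhx.
have momx n : moment l fx n - moment l hx n = l ^+ n * (f l - h l).
  case: n => [|n]; first by rewrite (in_Vhalf_moment0 l0 Vf) (in_Vhalf_moment0 l0 Vh) mul1r.
  by rewrite (in_Vhalf_momentS l0 _ Vf) (in_Vhalf_momentS l0 _ Vh) mom; ring.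
have di := integrableRB (measurable_itv _) fxi hxi.
(* Multiplying by [l - x] cancels the boundary terms in [momx]. *)
have dli : mu.-integrable `]0, l[ (EFin \o (fun x => (fx x - hx x) * (-1 * x + l))).
  have := integrable_mul_smooth di (@smooth_affine_exp R (-1) l 1).
  by apply: eq_integrableR => // x _; rewrite expr1.
have dn n : mu.-integrable `]0, l[ (EFin \o (fun x => (fx x - hx x) * x ^+ n)) /\
    \int[mu]_(x in `]0, l[) ((fx x - hx x) * x ^+ n) = l ^+ n * (f l - h l).
  split; first exact: integrable_mul_smooth di (@smooth_exp R n).
  rewrite -momx -RintegralB//.
  - by apply: eq_Rintegral => x _; rewrite mulrBl.
  - exact: integrable_mul_smooth fxi (@smooth_exp R n).
  - exact: integrable_mul_smooth hxi (@smooth_exp R n).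
have zero n : \int[mu]_(x in `]0, l[) (x ^+ n * ((fx x - hx x) * (-1 * x + l))) = 0.
  have [i1 I1] := dn n; have [i2 I2] := dn n.+1.
  transitivity (\int[mu]_(x in `]0, l[) (l * ((fx x - hx x) * x ^+ n)) -
                \int[mu]_(x in `]0, l[) ((fx x - hx x) * x ^+ n.+1)).
    rewrite -RintegralB//; last exact: integrableRZ.
    by apply: eq_Rintegral => x _; rewrite exprS; ring.
  by rewrite RintegralZl// I1 I2 exprS; ring.
apply: filterS (moments_ae0 dli zero) => x h0; rewrite /= in_itv/= => /andP[x0 xl].
have := h0 _; rewrite x0 xl => /(_ isT)/eqP; rewrite mulf_eq0 => /orP[|].
  by rewrite subr_eq0 => /eqP.
by rewrite mulN1r addrC subr_eq0 => /eqP lx; rewrite lx ltxx in xl.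
Qed.

(** Makes the bound independent of the solution: the right-hand side contains only the data and a
    chosen weak derivative of [y0]. *)
Lemma initial_energyE (nu : R) (y0 y0x y1 : R -> R) (y y_x y_t : R -> R -> R) (z : R -> R) :
  in_Vhalf l y0 y0x -> in_L2 `]0, l[ y1 -> weak_solution l nu y0 y1 y y_x y_t z ->
  energy l y_x y_t 0 = energy l (fun=> y0x) (fun=> y1) 0.
Proof.
move=> V0 y12 sol; have FF := ae_filter_ringOfSetsType mu.
have ex := in_Vhalf_derivative_unique (y_in_Vhalf sol (lexx 0)) V0 (sol_init sol).
have [[_ y0x2 _] _ _] := V0.
have x2i := in_L2_sqr_integrable (measurable_itv _) (y_x_in_L2 sol (lexx 0)).
have t2i := in_L2_sqr_integrable (measurable_itv _) (y_t_in_L2 sol (lexx 0)).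
have i0 := integrableRD (measurable_itv _) x2i t2i.
have i1 := integrableRD (measurable_itv _) (in_L2_sqr_integrable (measurable_itv _) y0x2)
  (in_L2_sqr_integrable (measurable_itv _) y12).
rewrite /energy; congr (_ * _).
have [] // := ae_eq_Rintegral (measurable_itv `]0, l[) (integrableR_measurable i1) i0.
by apply: filterS2 ex (sol_init_t sol) => x h1 h2 x0l; rewrite h1// h2.
Qed.

End initial_energy.

Theorem theorem2p3 (R : realType) (l mu : R)
    (hl : 0 < l) (hmu0 : 0 < mu) (hmu1 : mu < 1) :
  exists2 omega : R, 0 < omega &
  forall y0 y1 : R -> R,
    (exists y0x : R -> R, in_Vhalf l y0 y0x) -> in_L2 `]0, l[ y1 ->
  exists2 M : R, 0 < M &
  forall (y y_x y_t : R -> R -> R) (z : R -> R),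
    weak_solution l mu y0 y1 y y_x y_t z ->
  forall t : R, 0 <= t -> energy l y_x y_t t <= M * expR (- omega * t).
Proof.
have r0 := rate_gt0 hmu0 hmu1; have g0 := gap_gt0 hmu0 hmu1.
exists (- (ln (rate mu) / (2 * l))).
  rewrite oppr_gt0 pmulr_llt0 ?invr_gt0 ?mulr_gt0//.
  by rewrite ln_lt0// r0 rate_lt1.
move=> y0 y1 [y0x V0] y12.
(* The added 1 makes [M] positive even for zero data. *)
exists (8 / gap mu / rate mu * energy l (fun=> y0x) (fun=> y1) 0 + 1).
  have c0 : 0 <= 8 / gap mu / rate mu by rewrite divr_ge0 ?(ltW r0)// divr_ge0// ltW.
  by rewrite ltr_wpDl// mulr_ge0// energy_ge0.
move=> y y_x y_t z sol t t0; rewrite opprK.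
apply: (le_trans (energy_decay hl hmu0 hmu1 sol t0)).
by rewrite (initial_energyE hl V0 y12 sol) ler_wpM2r ?expR_ge0// lerDl.
Qed.
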